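(* Assume $\mu$ is irreducible and contracting, let $s\in I_\mu$, and for $n\ge1$ let $$h_\alpha(n)=\frac{1}{k(s)^n}\int_{M_d(\mathbb{C})^n}\|\wedge^2(v_n\cdots v_1)\|^\alpha\,\|v_n\cdots v_1\|^{s-2\alpha}\,d\mu^{\otimes n}(v_1,\dots,v_n).$$ Then $h_\alpha(n)\to0$ as $n\to\infty$. In particular, there exist $0<\lambda<1$ and $n_0\in\mathbb{N}$ such that for every $n\ge n_0$, $h_\alpha(n)\le\lambda^n$.
   Context: $d\ge1$; $\|\cdot\|$ is the Euclidean norm on $\mathbb{C}^d$ and the induced operator norm on $M_d(\mathbb{C})$. $\mu$ is a Borel measure on $M_d(\mathbb{C})$; $0<s_-<s_+\le+\infty$, $\int\|v\|^sd\mu(v)<\infty$ for every finite $s\in[s_-,s_+]$, $I_\mu=(s_-,s_+)$, $\alpha=\min\{s_-/3,1\}$. $k(s)=\lim_{n}\left(\int\|v_n\cdots v_1\|^sd\mu^{\otimes n}\right)^{1/n}$, which is positive for $s\in I_\mu$. $\mu$ is irreducible if no linear subspace $F$ with $\{0\}\ne F\ne\mathbb{C}^d$ satisfies $vF\subset F$ for all $v\in\operatorname{supp}\mu$. $\mu$ is contracting if, with $T$ the set of all finite products of elements of $\operatorname{supp}\mu$ together with the identity, there is a sequence of nonzero $v_k\in T$ such that $v_k/\|v_k\|$ converges to a rank-one matrix. $\wedge^2A$ is the linear map on $\wedge^2\mathbb{C}^d$ with $\wedge^2A(x_1\wedge x_2)=Ax_1\wedge Ax_2$, and $\|\wedge^2A\|$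 is its operator norm for the Hermitian inner product $\langle x_1\wedge x_2,y_1\wedge y_2\rangle=\det(\langle x_i,y_j\rangle)_{i,j=1}^2$. *)

(* Defs.v *)
From HB Require Import structures.
From mathcomp Require Import all_boot all_order all_algebra.
From mathcomp Require Import complex.
From mathcomp Require Import all_classical all_reals all_analysis.
From mathcomp Require Import ring.

Set Implicit Arguments.
Unset Strict Implicit.
Unset Printing Implicit Defensive.

Import Order.TTheory GRing.Theory Num.Theory.
Import numFieldNormedType.Exports.

Local Open Scope classical_set_scope.
Local Open Scope ring_scope.

(* The topology of R[i] is the one given by the modulus; 'M[R[i]]_d then has
   the product topology, which is the topology of any norm. *)
HB.instance Definition _ (R : realType) :=
  NormedModule.copy R[i] (R[i])^o.

(* Measurable sets of M_d(C) are the Borel sets. *)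
HB.instance Definition _ (R : realType) (d : nat) :=
  @isMeasurable.Build (sigma_display (@open 'M[R[i]]_d)) 'M[R[i]]_d
    <<s @open 'M[R[i]]_d >> (@sigma_algebra0 _ setT _) (@sigma_algebraC _ _)
    (@sigma_algebra_bigcup _ setT _).

Section Norms.
Context {R : realType} {d : nat}.
Local Notation C := (R[i]).

Definition cdot (x y : 'cV[C]_d) : C := \sum_i x i 0 * (y i 0)^*.

Definition vnorm (x : 'cV[C]_d) : R := Num.sqrt (complex.Re (cdot x x)).

Definition opnorm (A : 'M[C]_d) : R :=
  sup [set vnorm (A *m x) | x in [set x | vnorm x <= 1]].

End Norms.

(* The exterior square of C^d is realized as the space of antisymmetric d x d
   matrices, with x /\ y := x y^T - y x^T; e_i /\ e_j (i < j) is a basis, see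
   alternatingE.  Under this identification the linear map \wedge^2 A is
   X |-> A X A^T (ext2_wedge) and the inner product given by the Gram
   determinants is half the Frobenius inner product (ext2_dot_wedge). *)
Section ExteriorSquare.
Context {R : realType} {d : nat}.
Local Notation C := (R[i]).

Definition alternating (X : 'M[C]_d) : Prop := X^T = - X.

Definition wedge (x y : 'cV[C]_d) : 'M[C]_d := x *m y^T - y *m x^T.

Definition ext2 (A X : 'M[C]_d) : 'M[C]_d := A *m X *m A^T.

Definition ext2_dot (X Y : 'M[C]_d) : C :=
  2^-1 * \sum_i \sum_j X i j * (Y i j)^*.

Definition ext2_vnorm (X : 'M[C]_d) : R :=
  Num.sqrt (complex.Re (ext2_dot X X)).

Definition ext2_norm (A : 'M[C]_d) : R :=
  sup [set ext2_vnorm (ext2 A X) |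
       X in [set X | alternating X /\ ext2_vnorm X <= 1]].

Lemma alternating_wedge x y : alternating (wedge x y).
Proof.
by rewrite /alternating /wedge linearB /= !trmx_mul !trmxK opprB.
Qed.

Lemma alternatingE X : alternating X ->
  X = \sum_(i < d) \sum_(j < d | (i < j)%N) X i j *: wedge (delta_mx i 0) (delta_mx j 0).
Proof.
move=> Xalt.
have XT k l : X l k = - X k l by move/matrixP/(_ k l): Xalt; rewrite !mxE.
have X0 k : X k k = 0.
  have : X k k *+ 2 == 0 by rewrite mulr2n {2}XT subrr.
  by rewrite mulrn_eq0 => /eqP.
have wE i j : wedge (delta_mx i 0) (delta_mx j 0) =
    delta_mx i j - delta_mx j i :> 'M[C]_d.
  by rewrite /wedge !trmx_delta !mul_delta_mx.
rewrite [LHS]matrix_sum_delta.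
under [RHS]eq_bigr => i _ do under eq_bigr => j _ do rewrite wE scalerBr.
under [RHS]eq_bigr => i _ do rewrite sumrB.
rewrite sumrB.
rewrite [X in _ = _ - X](exchange_big_dep xpredT) //= -sumrB.
apply: eq_bigr => i _.
rewrite (bigID (fun j : 'I_d => (i < j)%N)) /=; congr (_ + _).
rewrite (bigID (fun j : 'I_d => (j < i)%N)) /= [X in _ + X]big1 ?addr0.
  rewrite -sumrN; apply: eq_big => [j|j _].
    by case: ltngtP.
  by rewrite XT scaleNr.
move=> j; rewrite -!leqNgt => /andP[ji ij].
have -> : i = j by apply/val_inj/eqP; rewrite eqn_leq ij ji.
by rewrite X0 scale0r.
Qed.

Lemma ext2_alternating A X : alternating X -> alternating (ext2 A X).
Proof.
rewrite /alternating /ext2 => XT.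
by rewrite !trmx_mul trmxK XT mulNmx mulmxN mulmxA.
Qed.

Lemma ext2_wedge A x y : ext2 A (wedge x y) = wedge (A *m x) (A *m y).
Proof.
by rewrite /ext2 /wedge mulmxBr mulmxBl !trmx_mul !mulmxA.
Qed.

Lemma ext2_dot_wedge (x y : 'I_2 -> 'cV[C]_d) :
  ext2_dot (wedge (x 0) (x 1)) (wedge (y 0) (y 1)) =
  \det (\matrix_(i < 2, j < 2) cdot (x i) (y j)).
Proof.
pose e (a b u v : 'cV[C]_d) i j := (a i 0 * b j 0) * (u i 0 * v j 0)^*.
have eE a b u v : \sum_i \sum_j e a b u v i j = cdot a u * cdot b v.
  rewrite /cdot big_distrl /=; apply: eq_bigr => i _.
  rewrite big_distrr /=; apply: eq_bigr => j _.
  by rewrite /e rmorphM /= mulrACA.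
have WE (a b : 'cV[C]_d) i j :
    wedge a b i j = a i 0 * b j 0 - b i 0 * a j 0.
  by rewrite /wedge !mxE !big_ord1 !mxE.
rewrite (expand_det_row _ 0) !big_ord_recl big_ord0 /cofactor !det_mx11 !mxE.
rewrite /= expr0 expr1 mul1r mulN1r addr0 mulrN.
have -> : lift 0 0 = 1 :> 'I_2 by apply/val_inj.
have -> : lift 1 0 = 0 :> 'I_2 by apply/val_inj.
rewrite /ext2_dot.
under eq_bigr => i _.
  under eq_bigr => j _.
    rewrite !WE.
    have -> : (x 0 i 0 * x 1 j 0 - x 1 i 0 * x 0 j 0) *
        (y 0 i 0 * y 1 j 0 - y 1 i 0 * y 0 j 0)^* =
        (e (x 0) (x 1) (y 0) (y 1) i j + e (x 1) (x 0) (y 1) (y 0) i j) -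
        (e (x 0) (x 1) (y 1) (y 0) i j + e (x 1) (x 0) (y 0) (y 1) i j).
      by rewrite /e rmorphB /=; ring.
    over.
  rewrite sumrB !big_split /=.
  over.
rewrite sumrB !big_split /= !eE.
by field.
Qed.

End ExteriorSquare.

(* The n-fold product measure on n-tuples, built from the library's binary
   product.  It is defined as a set function for every mu (no measure instance,
   hence no sigma-finiteness, is needed) and has the usual value on measurable
   boxes (pow_measure_box). *)
Fixpoint pow_measure {R : realType} {disp : measure_display}
    {T : measurableType disp} (mu : set T -> \bar R) (n : nat) :
    set (n.-tuple T) -> \bar R :=
  match n with
  | 0 => fun A => \d_([tuple] : 0.-tuple T) A
  | n'.+1 => fun A => (mu \x pow_measure mu (n := n'))%E
                        [set p : T * n'.-tuple T | A [tuple of p.1 :: p.2]]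
  end.
Arguments pow_measure {R disp T} mu n _.

Lemma pow_measure0 (R : realType) (disp : measure_display)
    (T : measurableType disp) (mu : {measure set T -> \bar R}) (n : nat) :
  pow_measure mu n set0 = 0%E.
Proof.
elim: n => [|n IH] /=; first exact: measure0.
rewrite /product_measure1 integral0_eq // => x _ /=.
by rewrite (_ : xsection _ x = set0) // -subset0 => t /xsectionP.
Qed.

Lemma pow_measure_box (R : realType) (disp : measure_display)
    (T : measurableType disp) (mu : {measure set T -> \bar R}) (n : nat)
    (A : 'I_n -> set T) : (forall i, measurable (A i)) ->
  pow_measure mu n [set t | forall i, A i (tnth t i)] =
  (\prod_(i < n) mu (A i))%E.
Proof.
elim: n A => [|n IH] A mA.
  by rewrite big_ord0 /= diracE mem_set // => -[].
rewrite big_ord_recl /= -(IH (fun i => A (lift ord0 i))) => [|i]; last exact: mA.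
set B := [set t | forall i, A (lift ord0 i) (tnth t i)].
rewrite muleC -integral_cst // /product_measure1 [RHS]integral_mkcond.
apply: eq_integral => x _ /=; rewrite patchE; case: ifPn => xA.
  congr pow_measure; apply/seteqP; split => t.
    by move=> /xsectionP /= At i; have := At (lift ord0 i); rewrite tnthS.
  move=> Bt; apply/xsectionP => /= i; case: (unliftP ord0 i) => [j|] ->.
    by rewrite tnthS; exact: Bt.
  by rewrite tnth0; exact: set_mem xA.
rewrite (_ : xsection _ x = set0) ?pow_measure0 // -subset0 => t /xsectionP /=.
by move=> /(_ ord0); rewrite tnth0 => xA0; rewrite mem_set in xA.
Qed.

Section RandomProducts.
Context {R : realType} {d : nat}.
Local Notation M := 'M[R[i]]_d.
Implicit Types mu : set M -> \bar R.

(* v_n *m ... *m v_1, where v_1 is the head of the tuple. *)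
Definition mx_prod (n : nat) (t : n.-tuple M) : M :=
  foldl (fun P v => v *m P) 1%:M t.

Definition msupp mu : set M :=
  [set v | forall U : set M, open U -> U v -> (0 < mu U)%E].

Definition mx_irreducible mu : Prop :=
  ~ exists F : {vspace 'cV[R[i]]_d},
      [/\ F != 0%VS, F != fullv &
          forall v, msupp mu v -> forall x, x \in F -> v *m x \in F].

(* n = 0 gives the identity. *)
Definition mx_semigroup mu : set M :=
  [set v | exists (n : nat) (t : n.-tuple M),
             (forall i, msupp mu (tnth t i)) /\ v = mx_prod t].

Definition mx_contracting mu : Prop :=
  exists (v : nat -> M) (w : M),
    [/\ forall k, mx_semigroup mu (v k) /\ v k != 0,
        (fun k => real_complex R (opnorm (v k))^-1 *: v k) @ \oo --> w &
        \rank w = 1%N].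

Definition moment mu (s : R) (n : nat) : \bar R :=
  (\int[pow_measure mu n]_t ((opnorm (mx_prod t)) `^ s)%:E)%E.

(* The moments are submultiplicative in n, so the limit exists and is finite as
   soon as moment mu s 1 is finite. *)
Definition kfun mu (s : R) : R :=
  fine (limn (fun n => (moment mu s n `^ n%:R^-1)%E)).

Definition hfun mu (alpha s : R) (n : nat) : \bar R :=
  ((kfun mu s ^+ n)^-1%:E *
   \int[pow_measure mu n]_t
     (ext2_norm (mx_prod t) `^ alpha *
      opnorm (mx_prod t) `^ (s - 2 * alpha))%:E)%E.

End RandomProducts.

(* Main.v *)
Require Import Defs.
From HB Require Import structures.
From mathcomp Require Import all_boot all_order all_algebra.
From mathcomp Require Import complex.
From mathcomp Require Import all_classical all_reals all_analysis.
From mathcomp Require Import measurable_realfun.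
From mathcomp Require Import ring lra.

Set Implicit Arguments.
Unset Strict Implicit.
Unset Printing Implicit Defensive.

Import Order.TTheory GRing.Theory Num.Theory.
Import numFieldNormedType.Exports.

Local Open Scope classical_set_scope.
Local Open Scope ring_scope.

(* Let P f (A) be the integral of f (v A) over mu(dv), N = ||.||^s and
   phi = ||wedge^2 .||^alpha ||.||^(s - 2 alpha) <= N, so that h(n) is
   k(s)^-n (P^n phi)(1).  Irreducibility and compactness of the unit sphere give
   c N(A) (P^n N)(1) <= \sum_(j < J) (P^(j + n) N)(A), so the moments are almost
   multiplicative, k(s)^n is comparable to (P^n N)(1), and k(s)^-n P^n g is bounded
   below by a multiple of N for g := \sum_(j < J) P^j N.
   Put F := limsup k(s)^-n P^n phi and G := liminf k(s)^-n P^n g: both are continuous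
   and s-homogeneous, with P F >= k(s) F, P G <= k(s) G and G > 0 away from 0.  The
   maximum r of F / G is attained, and F = r G propagates from A to v A for v in the
   support of mu.  Irreducibility and contraction lead to a nonzero matrix of rank
   one, where phi and hence F vanishes; so r = 0, F = 0 and h(n) -> 0.  As h is
   submultiplicative, the decay is exponential. *)

(** * Frobenius and operator norms *)

(** No eigenfunction of P is constructed: a limsup and a liminf of normalized iterates satisfy only
    one-sided inequalities, and these are the two that comparing F with G requires. What has to be
    secured is the continuity of the limits. It comes from the side on which A stands: P integrates
    over left factors, so (P^n f)(A) is an integral of f(S A) over products S, and for f continuous
    and s-homogeneous, compactness gives |f(S B) - f(S A)| <= e ||S||^s for B close to A, uniformly
    in S. After division by k(s)^n the error stays below a multiple of e for all n at once. The same
    convention turns irreducibility into an identity 1 = sum_l a_l A b_l with words a_l. It is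
    stable under perturbation and prevents all the v a_l A from being small compared with v; the
    words have different lengths, whence the sum over j < J. The choice alpha <= s_-/3 keeps s - 2
    alpha positive, so that phi is continuous. Tonelli's theorem asks for sigma-finiteness, which is
    obtained at the end by removing the zero matrix. *)

Section L2Sums.
Variables (R : rcfType) (I : finType).
Implicit Types a b : I -> R.

Lemma sumr_sqr_ge0 a : 0 <= \sum_i a i ^+ 2.
Proof. by apply: sumr_ge0 => i _; exact: sqr_ge0. Qed.

(** Cauchy-Schwarz, from expanding the nonnegative sum of the [(B * a i - A * b i) ^+ 2]. The
    expansion carries the factor [2 * (A * B)], so a vanishing [A] or [B] is treated apart: every
    term is then zero. *)
Lemma sum_mul_le_sqrt a b :
  \sum_i a i * b i <= Num.sqrt (\sum_i a i ^+ 2) * Num.sqrt (\sum_i b i ^+ 2).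
Proof.
set A := Num.sqrt _; set B := Num.sqrt _.
have AE : A ^+ 2 = \sum_i a i ^+ 2 by rewrite sqr_sqrtr // sumr_sqr_ge0.
have BE : B ^+ 2 = \sum_i b i ^+ 2 by rewrite sqr_sqrtr // sumr_sqr_ge0.
have [A0|A0] := eqVneq A 0.
  rewrite A0 mul0r big1 // => i _.
  move/esym: AE; rewrite A0 expr0n /= => /psumr_eq0P -/(_ (fun i _ => sqr_ge0 _) i isT).
  by move=> /eqP; rewrite sqrf_eq0 => /eqP ->; rewrite mul0r.
have [B0|B0] := eqVneq B 0.
  rewrite B0 mulr0 big1 // => i _.
  move/esym: BE; rewrite B0 expr0n /= => /psumr_eq0P -/(_ (fun i _ => sqr_ge0 _) i isT).
  by move=> /eqP; rewrite sqrf_eq0 => /eqP ->; rewrite mulr0.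
have Agt : 0 < A by rewrite lt_neqAle eq_sym A0 sqrtr_ge0.
have Bgt : 0 < B by rewrite lt_neqAle eq_sym B0 sqrtr_ge0.
have : 0 <= \sum_i (B * a i - A * b i) ^+ 2 by exact: sumr_sqr_ge0.
have -> : \sum_i (B * a i - A * b i) ^+ 2 =
   2 * (A * B) * (A * B - \sum_i a i * b i).
  transitivity (\sum_i (B ^+ 2 * a i ^+ 2 + A ^+ 2 * b i ^+ 2 - 2 * (A * B) * (a i * b i))).
    by apply: eq_bigr => i _; ring.
  by rewrite sumrB big_split /= -!mulr_sumr -AE -BE; ring.
by rewrite pmulr_rge0 ?mulr_gt0 // subr_ge0.
Qed.

Lemma sqrt_sumD_le a b : Num.sqrt (\sum_i (a i + b i) ^+ 2) <=
  Num.sqrt (\sum_i a i ^+ 2) + Num.sqrt (\sum_i b i ^+ 2).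
Proof.
set A := Num.sqrt (\sum_i a i ^+ 2); set B := Num.sqrt (\sum_i b i ^+ 2).
have AB0 : 0 <= A + B by rewrite addr_ge0 // sqrtr_ge0.
rewrite -(ger0_norm AB0) -sqrtr_sqr ler_sqrt ?sqr_ge0 //.
have -> : \sum_i (a i + b i) ^+ 2 = \sum_i (a i ^+ 2 + b i ^+ 2 + 2 * (a i * b i)).
  by apply: eq_bigr => i _; ring.
rewrite !big_split /= -mulr_sumr.
have := sum_mul_le_sqrt a b; rewrite -/A -/B => h.
have AE : A ^+ 2 = \sum_i a i ^+ 2 by rewrite sqr_sqrtr // sumr_sqr_ge0.
have BE : B ^+ 2 = \sum_i b i ^+ 2 by rewrite sqr_sqrtr // sumr_sqr_ge0.
rewrite -AE -BE (_ : (A + B) ^+ 2 = A ^+ 2 + B ^+ 2 + 2 * (A * B)); last ring.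
by rewrite lerD2l ler_pM2l.
Qed.

End L2Sums.

Section Frobenius.
Context {R : realType}.
Local Notation C := R[i].
Local Notation normc := (@Normc.normc R).

Lemma normc_ge0 (z : C) : 0 <= normc z.
Proof. by case: z => a b; exact: sqrtr_ge0. Qed.

Lemma normc_real (x : R) : 0 <= x -> normc x%:C%C = x.
Proof. by move=> x0; rewrite /Normc.normc /= expr0n addr0 sqrtr_sqr ger0_norm. Qed.

Definition frob m n (X : 'M[C]_(m, n)) : R :=
  Num.sqrt (\sum_(p : 'I_m * 'I_n) normc (X p.1 p.2) ^+ 2).

Lemma frob_ge0 m n (X : 'M[C]_(m, n)) : 0 <= frob X.
Proof. exact: sqrtr_ge0. Qed.

Lemma sqr_frob m n (X : 'M[C]_(m, n)) :
  frob X ^+ 2 = \sum_i \sum_j normc (X i j) ^+ 2.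
Proof. by rewrite sqr_sqrtr ?sumr_sqr_ge0 // pair_bigA. Qed.

Lemma frob0 m n : frob (0 : 'M[C]_(m, n)) = 0.
Proof.
rewrite /frob big1 ?sqrtr0 // => p _.
by rewrite mxE Normc.normc0 expr0n.
Qed.

Lemma normc_le_frob m n (X : 'M[C]_(m, n)) i j : normc (X i j) <= frob X.
Proof.
rewrite -(ger0_norm (normc_ge0 _)) -sqrtr_sqr ler_sqrt ?sumr_sqr_ge0 //.
rewrite (bigD1 (i, j)) //= lerDl; apply: sumr_ge0 => p _; exact: sqr_ge0.
Qed.

Lemma frob_eq0 m n (X : 'M[C]_(m, n)) : frob X = 0 -> X = 0.
Proof.
move=> X0; apply/matrixP => i j; rewrite mxE; apply: Normc.eq0_normc.
by apply/le_anti; rewrite normc_ge0 -{1}X0 normc_le_frob.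
Qed.

Lemma frobZ m n c (X : 'M[C]_(m, n)) : frob (c *: X) = normc c * frob X.
Proof.
rewrite -[in RHS](ger0_norm (normc_ge0 c)) -sqrtr_sqr -sqrtrM ?sqr_ge0 //.
rewrite mulr_sumr; congr Num.sqrt; apply: eq_bigr => p _.
by rewrite mxE Normc.normcM exprMn.
Qed.

Lemma frobD m n (X Y : 'M[C]_(m, n)) : frob (X + Y) <= frob X + frob Y.
Proof.
apply: le_trans (sqrt_sumD_le _ _); rewrite ler_sqrt ?sumr_sqr_ge0 //.
apply: ler_sum => p _; rewrite mxE ler_sqr ?nnegrE ?normc_ge0 ?addr_ge0 ?normc_ge0 //.
exact: le_normcD.
Qed.

Lemma frob_tr m n (X : 'M[C]_(m, n)) : frob X^T = frob X.
Proof.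
rewrite -(ger0_norm (frob_ge0 X^T)) -(ger0_norm (frob_ge0 X)) -!sqrtr_sqr.
rewrite !sqr_frob exchange_big; congr Num.sqrt.
by apply: eq_bigr => i _; apply: eq_bigr => j _; rewrite mxE.
Qed.

Lemma sqr_frob_col m n (X : 'M[C]_(m, n)) :
  frob X ^+ 2 = \sum_j frob (col j X) ^+ 2.
Proof.
rewrite sqr_frob exchange_big; apply: eq_bigr => j _.
by rewrite sqr_frob; apply: eq_bigr => i _; rewrite big_ord1 mxE.
Qed.

Lemma mul_conj_normc (z : C) : z * z^*%C = (normc z ^+ 2)%:C%C.
Proof. by rewrite -sqr_normc rmorphXn /=; case: z => a b. Qed.

Lemma Re_sum (I : finType) (F : I -> C) :
  complex.Re (\sum_i F i) = \sum_i complex.Re (F i).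
Proof. exact: (big_morph (@complex.Re R) (fun x y => raddfD _ x y)). Qed.

Lemma vnormE d (x : 'cV[C]_d) : vnorm x = frob x.
Proof.
rewrite /vnorm /frob /cdot Re_sum -(pair_bigA _ (fun i j => normc (x i j) ^+ 2)) /=.
congr Num.sqrt; apply: eq_bigr => i _; rewrite big_ord1.
have -> : x i 0 * (x i 0)^* = x i 0 * (x i 0)^*%C by [].
by rewrite mul_conj_normc.
Qed.

Lemma ext2_vnormE d (X : 'M[C]_d) :
  ext2_vnorm X = Num.sqrt 2^-1 * frob X.
Proof.
rewrite /ext2_vnorm /frob /ext2_dot -sqrtrM ?invr_ge0 //; congr Num.sqrt.
have -> : \sum_i \sum_j X i j * (X i j)^* = (frob X ^+ 2)%:C%C.
  rewrite sqr_frob raddf_sum; apply: eq_bigr => i _.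
  by rewrite raddf_sum; apply: eq_bigr => j _; exact: mul_conj_normc.
have -> : (2^-1 : C) = (2^-1)%:C%C by rewrite fmorphV rmorph_nat.
by rewrite -rmorphM /= sqr_sqrtr ?sumr_sqr_ge0.
Qed.

(** A crude constant, whose only use is to show that the supremum defining the operator norm runs
    over a bounded set. *)
Lemma frob_mulmx_bounded m n (A : 'M[C]_(m, n)) (x : 'cV[C]_n) :
  frob (A *m x) <= (\sum_j frob (col j A)) * frob x.
Proof.
have -> : A *m x = \sum_j x j 0 *: col j A.
  apply/matrixP => i k; rewrite !mxE summxE ord1; apply: eq_bigr => j _.
  by rewrite !mxE mulrC.
elim/big_ind2 : _ => [|X a Y b hX hY|j _].
- by rewrite frob0 mul0r.
- by rewrite mulrDl (le_trans (frobD _ _)) // lerD.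
- by rewrite frobZ mulrC ler_wpM2l ?frob_ge0 // normc_le_frob.
Qed.

End Frobenius.

(* [opnorm] and [ext2_norm] are locked because unification otherwise unfolds
   the suprema. *)
HB.lock Definition onorm (R : realType) (d : nat) (A : 'M[R[i]]_d) : R := opnorm A.
HB.lock Definition wnorm (R : realType) (d : nat) (A : 'M[R[i]]_d) : R := ext2_norm A.

Section OperatorNorm.
Context {R : realType}.
Local Notation alternating := Defs.alternating.
Local Notation C := R[i].
Local Notation normc := (@Normc.normc R).

Section SupNorm.
Variables (m n : nat) (D : 'M[C]_(m, n) -> Prop) (L : 'M[C]_(m, n) -> 'M[C]_(m, n)).
Variables (k : R).
Hypothesis k_gt0 : 0 < k.
Hypothesis D0 : D 0.
Hypothesis DZ : forall c X, D X -> D (c *: X).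
Hypothesis LZ : forall c X, L (c *: X) = c *: L X.
Let S := [set k * frob (L X) | X in [set X | D X /\ k * frob X <= 1]].

Lemma supnorm_le c : 0 <= c -> (forall X, D X -> frob (L X) <= c * frob X) ->
  sup S <= c.
Proof.
move=> c0 h; apply: ge_sup.
  exists (k * frob (L 0)); exists 0 => //; split => //.
  by rewrite frob0 mulr0 ler01.
move=> _ [X [DX X1] <-].
apply: (@le_trans _ _ (c * (k * frob X))); last by rewrite ler_piMr.
by rewrite mulrCA ler_pM2l // h.
Qed.

(** Rescaling [X] to the boundary of the unit ball turns the supremum into an admissible constant,
    and [k] cancels. [opnorm] is the case of all column vectors with [k = 1], [ext2_norm] that of
    alternating matrices with [k = Num.sqrt 2^-1]. The a priori constant [c] bounds [S] and settles
    [frob X = 0]. *)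
Lemma supnorm_ub c X : (forall X, D X -> frob (L X) <= c * frob X) ->
  D X -> frob (L X) <= sup S * frob X.
Proof.
move=> h DX; have [X0|Xn0] := eqVneq (frob X) 0.
  by have := h X DX; rewrite X0 !mulr0.
have Xgt : 0 < frob X by rewrite lt_neqAle eq_sym Xn0 frob_ge0.
have c0 : 0 <= c.
  by rewrite -(pmulr_lge0 _ Xgt) (le_trans _ (h X DX)) // frob_ge0.
have hS : has_ubound S.
  exists c => _ [Y [DY Y1] <-].
  apply: (@le_trans _ _ (c * (k * frob Y))); last by rewrite ler_piMr.
  by rewrite mulrCA ler_pM2l // h.
pose a := ((k * frob X)^-1)%:C%C.
have na : normc a = (k * frob X)^-1.
  by rewrite normc_real // invr_ge0 mulr_ge0 // ltW.
have : k * frob (L (a *: X)) <= sup S.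
  apply: (ub_le_sup hS); exists (a *: X) => //; split; first exact: DZ.
  by rewrite frobZ na mulrCA mulVf // mulf_neq0 // gt_eqF.
rewrite LZ frobZ na (_ : k * _ = frob (L X) / frob X); last first.
  by field; rewrite Xn0 gt_eqF.
by rewrite ler_pdivrMr.
Qed.

End SupNorm.

Variable d : nat.
Implicit Types (A B X Y : 'M[C]_d).

Lemma onormE A : onorm A =
  sup [set 1 * frob (A *m x) | x in [set x : 'cV[C]_d | True /\ 1 * frob x <= 1]].
Proof.
rewrite onorm.unlock /opnorm; congr sup; apply/seteqP; split => _ [x hx <-].
  by exists x; rewrite /= ?mul1r ?vnormE //; split => //; rewrite -vnormE.
by exists x; rewrite /= ?mul1r ?vnormE //; case: hx => _; rewrite mul1r.
Qed.

Lemma wnormE A : wnorm A =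
  sup [set Num.sqrt 2^-1 * frob (ext2 A X) | X in
    [set X | alternating X /\ Num.sqrt 2^-1 * frob X <= 1]].
Proof.
rewrite wnorm.unlock /ext2_norm; congr sup; apply/seteqP; split => _ [X [Xalt hX] <-].
  by exists X; rewrite /= ?ext2_vnormE //; split => //; rewrite -ext2_vnormE.
by exists X; rewrite /= ?ext2_vnormE.
Qed.

Lemma onorm_le c A : 0 <= c -> (forall x : 'cV_d, frob (A *m x) <= c * frob x) ->
  onorm A <= c.
Proof.
by move=> c0 h; rewrite onormE; apply: supnorm_le => // X _; exact: h.
Qed.

Lemma frob_mulmx_col A (x : 'cV_d) : frob (A *m x) <= onorm A * frob x.
Proof.
rewrite onormE; apply: supnorm_ub => //.
- by move=> c X; rewrite scalemxAr.
- by move=> X _; exact: frob_mulmx_bounded.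
Qed.

Lemma normc_le_onorm A i j : normc (A i j) <= onorm A.
Proof.
have := frob_mulmx_col A (delta_mx j 0).
have -> : frob (delta_mx j 0 : 'cV[C]_d) = 1.
  rewrite /frob (bigD1 (j, 0)) //= big1 => [|[a b]].
    by rewrite mxE !eqxx Normc.normc1 expr1n addr0 sqrtr1.
  rewrite /= mxE (ord1 b) eqxx andbT; have [->|aj _] := eqVneq a j.
    by rewrite eqxx.
  by rewrite Normc.normc0 expr0n.
rewrite mulr1 -colE; apply: le_trans.
have -> : A i j = col j A i 0 by rewrite mxE.
exact: normc_le_frob.
Qed.

Lemma onorm_ge0 A : 0 <= onorm A.
Proof.
have [[i _]|no_i] := pselect (exists i : 'I_d, True).
  by rewrite (le_trans _ (normc_le_onorm A i i)) ?normc_ge0.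
have cV0 (x : 'cV[C]_d) : x = 0 by apply/matrixP => i; case: no_i; exists i.
rewrite onormE (_ : [set _ | _ in _] = [set 0]) ?sup1 //.
apply/seteqP; split => [_ [x _ <-]|_ ->] /=.
  by rewrite (cV0 (A *m x)) frob0 mulr0.
exists 0; first by rewrite /= frob0 mulr0 ler01.
by rewrite (_ : A *m 0 = 0) ?frob0 ?mulr0 // mulmx0.
Qed.

Lemma frob_mulmx m A (X : 'M[C]_(d, m)) : frob (A *m X) <= onorm A * frob X.
Proof.
rewrite -(ger0_norm (frob_ge0 _)) -sqrtr_sqr.
have O0 : 0 <= onorm A * frob X by rewrite mulr_ge0 ?onorm_ge0 ?frob_ge0.
rewrite -(ger0_norm O0) -sqrtr_sqr ler_sqrt ?sqr_ge0 // exprMn.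
rewrite sqr_frob_col (sqr_frob_col X) mulr_sumr; apply: ler_sum => j _.
rewrite -exprMn colE -mulmxA -colE ler_sqr ?nnegrE ?frob_ge0 ?mulr_ge0 ?onorm_ge0 ?frob_ge0 //.
exact: frob_mulmx_col.
Qed.

Lemma frob_mulmxr m A (X : 'M[C]_(m, d)) : frob (X *m A^T) <= onorm A * frob X.
Proof. by rewrite -frob_tr trmx_mul trmxK -(frob_tr X) frob_mulmx. Qed.

Lemma onorm0 : onorm (0 : 'M[C]_d) = 0.
Proof.
apply/le_anti; rewrite onorm_ge0 andbT.
by apply: onorm_le => // x; rewrite mul0mx frob0 mul0r.
Qed.

Lemma onorm_eq0 A : onorm A = 0 -> A = 0.
Proof.
move=> A0; apply/matrixP => i j; rewrite mxE; apply: Normc.eq0_normc.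
by apply/le_anti; rewrite normc_ge0 -{1}A0 normc_le_onorm.
Qed.

Lemma onorm_gt0 A : (0 < onorm A) = (A != 0).
Proof.
rewrite lt_neqAle onorm_ge0 andbT eq_sym; congr (~~ _).
by apply/eqP/eqP => [/onorm_eq0 //|->]; rewrite onorm0.
Qed.

Lemma onormZ_le c A : onorm (c *: A) <= normc c * onorm A.
Proof.
apply: onorm_le => [|x]; first by rewrite mulr_ge0 ?normc_ge0 ?onorm_ge0.
by rewrite -scalemxAl frobZ -mulrA ler_wpM2l ?normc_ge0 // frob_mulmx_col.
Qed.

Lemma onormZ c A : onorm (c *: A) = normc c * onorm A.
Proof.
apply/le_anti; rewrite onormZ_le /=.
have [->|c0] := eqVneq c 0.
  by rewrite Normc.normc0 mul0r onorm_ge0.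
have nc : 0 < normc c.
  rewrite lt_neqAle normc_ge0 andbT eq_sym; apply: contra c0.
  by move=> /eqP /Normc.eq0_normc ->.
have := onormZ_le c^-1 (c *: A).
by rewrite scalerA mulVf // scale1r Normc.normcV ler_pdivlMl.
Qed.

Lemma onormN A : onorm (- A) = onorm A.
Proof. by rewrite -scaleN1r onormZ normcN Normc.normc1 mul1r. Qed.

Lemma onormB A B : onorm (A - B) = onorm (B - A).
Proof. by rewrite -onormN opprB. Qed.

Lemma onormD A B : onorm (A + B) <= onorm A + onorm B.
Proof.
apply: onorm_le => [|x]; first by rewrite addr_ge0 ?onorm_ge0.
by rewrite mulmxDl mulrDl (le_trans (frobD _ _)) // lerD // frob_mulmx_col.
Qed.

Lemma onorm_sum (I : finType) (F : I -> 'M[C]_d) :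
  onorm (\sum_i F i) <= \sum_i onorm (F i).
Proof.
elim/big_ind2 : _ => [|A a B b hA hB|//]; first by rewrite onorm0.
by rewrite (le_trans (onormD _ _)) // lerD.
Qed.

Lemma onormM A B : onorm (A *m B) <= onorm A * onorm B.
Proof.
apply: onorm_le => [|x]; first by rewrite mulr_ge0 ?onorm_ge0.
rewrite -mulmxA (le_trans (frob_mulmx_col _ _)) // -mulrA.
by rewrite ler_wpM2l ?onorm_ge0 ?frob_mulmx_col.
Qed.

Lemma onorm_lip A B : `|onorm A - onorm B| <= onorm (A - B).
Proof.
have h1 : onorm A <= onorm (A - B) + onorm B.
  by have := onormD (A - B) B; rewrite subrK.
have h2 : onorm B <= onorm (A - B) + onorm A.
  by have := onormD (B - A) A; rewrite subrK (onormB B).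
by rewrite ler_norml lerBlDr h1 andbT lerNl opprB lerBlDr.
Qed.

(** Matrix units have norm one. Together with [normc_le_onorm] this identifies the entrywise
    topology with that of the operator norm. *)
Lemma onorm_le_sum A : onorm A <= \sum_i \sum_j normc (A i j).
Proof.
have -> : \sum_i \sum_j normc (A i j) = \sum_i \sum_j onorm (A i j *: (delta_mx i j : 'M[C]_d)).
  apply: eq_bigr => i _; apply: eq_bigr => j _; rewrite onormZ.
  suff -> : onorm (delta_mx i j : 'M[C]_d) = 1 by rewrite mulr1.
  apply/le_anti/andP; split; last first.
    have := normc_le_onorm (delta_mx i j) i j.
    by rewrite mxE !eqxx Normc.normc1.
  apply: onorm_le => // x; rewrite mul1r.
  rewrite -(ger0_norm (frob_ge0 _)) -(ger0_norm (frob_ge0 x)) -!sqrtr_sqr.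
  rewrite ler_sqrt ?sqr_ge0 // !sqr_frob (bigD1 i) //= !big_ord1 [X in _ + X]big1 ?addr0.
    rewrite (bigD1 j) //= big_ord1.
    have -> : (delta_mx i j *m x) i 0 = x j 0.
      rewrite mxE (bigD1 j) //= big1 ?addr0 => [|k kj].
        by rewrite mxE !eqxx mul1r.
      by rewrite mxE (negbTE kj) andbF mul0r.
    by rewrite lerDl; apply: sumr_ge0 => k _; apply: sumr_ge0 => l _; exact: sqr_ge0.
  move=> k ki; rewrite big_ord1 mxE big1 ?Normc.normc0 ?expr0n // => l _.
  by rewrite mxE (negbTE ki) mul0r.
rewrite {1}(matrix_sum_delta A) (le_trans (onorm_sum _)) //.
by apply: ler_sum => i _; exact: onorm_sum.
Qed.

Lemma onorm1 : (0 < d)%N -> onorm (1%:M : 'M[C]_d) = 1.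
Proof.
move=> d0; apply/le_anti/andP; split.
  by apply: onorm_le => // x; rewrite mul1mx mul1r.
have := normc_le_onorm 1%:M (Ordinal d0) (Ordinal d0).
by rewrite mxE eqxx Normc.normc1.
Qed.

Lemma frob_ext2_le A X : frob (ext2 A X) <= onorm A ^+ 2 * frob X.
Proof.
rewrite (le_trans (frob_mulmxr _ _)) // expr2 -mulrA.
by rewrite ler_wpM2l ?onorm_ge0 // frob_mulmx.
Qed.

Let k_gt0 : 0 < Num.sqrt (2^-1 : R).
Proof. by rewrite sqrtr_gt0 invr_gt0. Qed.

Let alternating0 : alternating (0 : 'M[C]_d).
Proof. by rewrite /alternating trmx0 oppr0. Qed.

Let alternatingZ c X : alternating X -> alternating (c *: X).
Proof. by rewrite /alternating linearZ /= => ->; rewrite scalerN. Qed.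

Lemma wnorm_le c A : 0 <= c ->
  (forall X, alternating X -> frob (ext2 A X) <= c * frob X) -> wnorm A <= c.
Proof. by move=> c0 h; rewrite wnormE; apply: supnorm_le. Qed.

Lemma frob_ext2 A X : alternating X -> frob (ext2 A X) <= wnorm A * frob X.
Proof.
move=> Xalt; rewrite wnormE.
apply: (supnorm_ub (L := ext2 A)) => //.
- by move=> c Y; rewrite /ext2 -scalemxAr -scalemxAl.
- by move=> Y _; exact: frob_ext2_le.
Qed.

Lemma wnorm_ge0 A : 0 <= wnorm A.
Proof.
have [[X [Xalt X0]]|h] := pselect (exists X, alternating X /\ X != 0).
  have Xgt : 0 < frob X.
    rewrite lt_neqAle frob_ge0 andbT eq_sym; apply: contra X0.
    by move=> /eqP /frob_eq0 ->.
  by rewrite -(pmulr_lge0 _ Xgt) (le_trans _ (frob_ext2 _ Xalt)) // frob_ge0.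
rewrite wnormE (_ : [set _ | _ in _] = [set 0]) ?sup1 //.
apply/seteqP; split => [_ [X [Xalt _] <-]|_ ->] /=; last first.
  exists 0; last by rewrite /ext2 mulmx0 mul0mx frob0 mulr0.
  by split => //; rewrite frob0 mulr0 ler01.
have -> : X = 0 by apply: contrapT => /eqP X0; apply: h; exists X.
by rewrite /ext2 mulmx0 mul0mx frob0 mulr0.
Qed.

Lemma wnorm_le_sqr A : wnorm A <= onorm A ^+ 2.
Proof. by apply: wnorm_le => [|X _]; [exact: sqr_ge0|exact: frob_ext2_le]. Qed.

Lemma wnormM A B : wnorm (A *m B) <= wnorm A * wnorm B.
Proof.
apply: wnorm_le => [|X Xalt]; first by rewrite mulr_ge0 ?wnorm_ge0.
have -> : ext2 (A *m B) X = ext2 A (ext2 B X).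
  by rewrite /ext2 trmx_mul !mulmxA.
rewrite (le_trans (frob_ext2 _ (ext2_alternating _ Xalt))) // -mulrA.
by rewrite ler_wpM2l ?wnorm_ge0 // frob_ext2.
Qed.

Lemma wnormZ_le c A : wnorm (c *: A) <= normc c ^+ 2 * wnorm A.
Proof.
apply: wnorm_le => [|X Xalt].
  by rewrite mulr_ge0 ?sqr_ge0 ?wnorm_ge0.
have -> : ext2 (c *: A) X = (c * c) *: ext2 A X.
  by rewrite /ext2 linearZ /= -!scalemxAl -scalemxAr scalerA.
rewrite frobZ Normc.normcM -expr2 -[X in _ <= X]mulrA.
by rewrite ler_wpM2l ?sqr_ge0 // frob_ext2.
Qed.

Lemma wnormZ c A : wnorm (c *: A) = normc c ^+ 2 * wnorm A.
Proof.
apply/le_anti; rewrite wnormZ_le /=.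
have [->|c0] := eqVneq c 0.
  by rewrite Normc.normc0 expr0n mul0r wnorm_ge0.
have nc : 0 < normc c ^+ 2.
  rewrite exprn_gt0 // lt_neqAle normc_ge0 andbT eq_sym; apply: contra c0.
  by move=> /eqP /Normc.eq0_normc ->.
have := wnormZ_le c^-1 (c *: A).
by rewrite scalerA mulVf // scale1r Normc.normcV exprVn ler_pdivlMl.
Qed.

(** From A X A^T - B X B^T = (A - B) X A^T + B X (A - B)^T. Exchanging [A] and [B] gives the other
    side, hence local Lipschitz continuity. *)
Lemma wnorm_le_lip A B :
  wnorm A <= wnorm B + onorm (A - B) * (onorm A + onorm B).
Proof.
apply: wnorm_le => [|X Xalt].
  by rewrite addr_ge0 ?wnorm_ge0 // mulr_ge0 ?addr_ge0 ?onorm_ge0.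
have -> : ext2 A X = ext2 B X + ((A - B) *m X *m A^T + B *m X *m (A - B)^T).
  by rewrite /ext2 (linearB trmx) !mulmxBl mulmxBr subrKA addrC subrK.
rewrite (le_trans (frobD _ _)) // mulrDl lerD ?frob_ext2 //.
rewrite (le_trans (frobD _ _)) // mulrDr mulrDl lerD //.
- rewrite (mulrC (onorm (A - B))) -mulrA (le_trans (frob_mulmxr _ _)) //.
  by rewrite ler_wpM2l ?onorm_ge0 ?frob_mulmx.
- rewrite (le_trans (frob_mulmxr _ _)) // -mulrA.
  by rewrite ler_wpM2l ?onorm_ge0 ?frob_mulmx.
Qed.

(* A = u w, and u (w X w^T) u^T = 0 because the scalar w X w^T is its own opposite. *)
Lemma wnorm_rank1 A : (\rank A <= 1)%N -> wnorm A = 0.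
Proof.
move=> rA; apply/le_anti; rewrite wnorm_ge0 andbT.
apply: wnorm_le => // X Xalt; rewrite mul0r.
rewrite /ext2 -(mulmx_base A); move: (row_base A) (col_base A) => w u.
have -> : u *m w *m X *m (u *m w)^T = u *m (w *m X *m w^T) *m u^T.
  by rewrite trmx_mul !mulmxA.
suff -> : w *m X *m w^T = 0 by rewrite mulmx0 mul0mx frob0.
have alt : (w *m X *m w^T)^T = - (w *m X *m w^T).
  have XT : X^T = - X := Xalt.
  by rewrite trmx_mul trmxK trmx_mul XT mulNmx mulmxN mulmxA.
move: (w *m X *m w^T) alt => Z alt.
apply/matrixP => i j; have -> : i = j.
  have := leq_trans (ltn_ord i) rA; have := leq_trans (ltn_ord j) rA.
  by rewrite !ltnS !leqn0 => /eqP j0 /eqP i0; apply/val_inj; rewrite /= i0 j0.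
move/matrixP : alt => /(_ j j); rewrite !mxE => /eqP.
by rewrite -addr_eq0 -mulr2n mulrn_eq0 => /eqP.
Qed.

End OperatorNorm.

(** * Topology and measurability of matrices *)

Section MatrixTopology.
Context {R : realType}.
Local Notation C := R[i].
Local Notation normc := (@Normc.normc R).

(** Radii of balls in a normed module over [R[i]] are complex numbers; this brings them back to
    [R]. *)
Lemma complex_gt0_real (e : C) : 0 < e -> exists2 r : R, 0 < r & e = r%:C%C.
Proof.
by rewrite ltcE; case: e => a b /= /andP[/eqP -> a0]; exists a.
Qed.

Lemma nbhs_mxP m n (X : 'M[C]_(m, n)) (U : set 'M[C]_(m, n)) :
  nbhs X U <-> exists2 e : R, 0 < e &
    forall Y : 'M[C]_(m, n), (forall i j, normc (Y i j - X i j) < e) -> U Y.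
Proof.
split=> [/nbhs_ballP [_ /= /complex_gt0_real [e e0 ->] eU]|[e e0 eU]].
  exists e => // Y hY.
  apply: eU; split => [|i j]; first by rewrite ltcR.
  by rewrite /ball /= /ball_ distrC -[`|_|]/((normc _)%:C%C) ltcR.
apply/nbhs_ballP; exists e%:C%C => /=; first by rewrite ltcR.
move=> Y [_ hY]; apply: eU => i j; have := hY i j.
by rewrite /ball /= /ball_ distrC -[`|_|]/((normc _)%:C%C) ltcR.
Qed.

Lemma nbhs_onormP d (A : 'M[C]_d) (U : set 'M[C]_d) :
  nbhs A U <-> exists2 e : R, 0 < e & forall B, onorm (B - A) < e -> U B.
Proof.
rewrite nbhs_mxP; split => -[e e0 eU].
  exists e => // B hB; apply: eU => i j; apply: le_lt_trans hB.
  by have := normc_le_onorm (B - A) i j; rewrite !mxE.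
have D0 : 0 < (d * d).+1%:R :> R by rewrite ltr0n.
exists (e / (d * d).+1%:R) => [|B hB]; first by rewrite divr_gt0.
apply: eU; apply: (le_lt_trans (onorm_le_sum _)).
apply: (@le_lt_trans _ _ (\sum_(i < d) \sum_(j < d) (e / (d * d).+1%:R))).
  apply: ler_sum => i _; apply: ler_sum => j _.
  by rewrite !mxE; exact/ltW/hB.
rewrite !sumr_const card_ord -mulrnA -[X in X < _]mulr_natr -mulrA gtr_pMr //.
by rewrite mulrC ltr_pdivrMr // mul1r ltr_nat.
Qed.

Lemma continuous_onormP d (f : 'M[C]_d -> R) (A : 'M[C]_d) :
  (forall e, 0 < e -> exists2 k : R, 0 < k &
     forall B, onorm (B - A) < k -> `|f B - f A| < e) -> {for A, continuous f}.
Proof.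
move=> h U /nbhs_ballP [e /= e0 eU]; have [k k0 hk] := h e e0.
apply/nbhs_onormP; exists k => // B /hk hB; apply: eU.
by rewrite /ball /= distrC.
Qed.

(** A product of squares: each square is the continuous image of a product of two segments, and
    [vec_mx] carries the compactness of products of rows over to matrices. *)
Lemma compact_mx_entries m n (r : R) :
  compact [set X : 'M[C]_(m, n) |
    forall i j, `|complex.Re (X i j)| <= r /\ `|complex.Im (X i j)| <= r].
Proof.
pose D := [set z : C | `|complex.Re z| <= r /\ `|complex.Im z| <= r].
have cD : compact D.
  pose f (p : R * R) : C := Complex p.1 p.2.
  have -> : D = f @` (`[- r, r]%classic `*` `[- r, r]%classic).
    apply/seteqP; split => [[a b] /= [ha hb]|_ [[a b] /= [ha hb] <-]].
      by exists (a, b) => //; split; rewrite /= in_itv /= -ler_norml.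
    by move: ha hb; rewrite !in_itv /= -!ler_norml.
  apply: continuous_compact; last first.
    by apply: compact_setX; exact: segment_compact.
  apply: continuous_subspaceT => -[a b] U.
  move=> /nbhs_ballP [_ /= /complex_gt0_real [e e0 ->] eU].
  have e20 : 0 < e / 2 by rewrite divr_gt0.
  exists (ball a (e / 2), ball b (e / 2)); first by split; exact: nbhsx_ballx.
  move=> [u v] [/= hu hv]; apply: eU.
  rewrite /ball /= /ball_ -[`|_|]/((normc _)%:C%C) ltcR.
  have -> : (f (a, b) - f (u, v)) = Complex (a - u) 0 + Complex 0 (b - v).
    by rewrite /f /=; apply/eqP; rewrite eq_complex /= addr0 add0r !eqxx.
  apply: (le_lt_trans (le_normcD _ _)).
  rewrite /Normc.normc !expr0n /= addr0 add0r !sqrtr_sqr [e]splitr.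
  by rewrite ltrD.
pose g (v : 'rV[C]_(m * n)) : 'M[C]_(m, n) := vec_mx v.
have -> : [set X : 'M[C]_(m, n) | forall i j, D (X i j)] =
    g @` [set v : 'rV[C]_(m * n) | forall i, D (v ord0 i)].
  apply/seteqP; split => [X hX|_ [v hv <-] i j]; last by rewrite mxE; exact: hv.
  exists (mxvec X); last exact: mxvecK.
  by move=> k; case/mxvec_indexP : k => i j; rewrite mxvecE; exact: hX.
apply: continuous_compact; last by apply: (rV_compact (A := fun=> D)) => _.
apply: continuous_subspaceT => v U /nbhs_mxP [e e0 eU]; apply/nbhs_mxP.
by exists e => // w hw; apply: eU => i j; rewrite !mxE; exact: hw.
Qed.

Variable d : nat.
Implicit Types (A B : 'M[C]_d).

Lemma onorm_continuous : continuous (@onorm R d).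
Proof.
move=> A; apply: continuous_onormP => e e0; exists e => // B hB.
by rewrite (le_lt_trans (onorm_lip _ _)).
Qed.

Lemma wnorm_continuous : continuous (@wnorm R d).
Proof.
move=> A; apply: continuous_onormP => e e0.
pose K := 2 * onorm A + 1.
have K0 : 0 < K by rewrite ltr_pwDr ?mulr_ge0 ?onorm_ge0.
exists (Num.min 1 (e / K)) => [|B]; first by rewrite lt_min ltr01 divr_gt0.
rewrite lt_min => /andP[h1 h2].
have BA : onorm A + onorm B <= K.
  have := onormD (B - A) A; rewrite subrK /K; move: h1.
  by move: (onorm A) (onorm B) (onorm (B - A)) => a b c; lra.
apply: (@le_lt_trans _ _ (onorm (B - A) * K)); last by rewrite -ltr_pdivlMr.
have hBA := wnorm_le_lip B A; have hAB := wnorm_le_lip A B.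
have hK : onorm (B - A) * (onorm A + onorm B) <= onorm (B - A) * K.
  by rewrite ler_wpM2l ?onorm_ge0.
rewrite (onormB A) in hAB; rewrite (addrC (onorm B)) in hBA.
rewrite ler_distl lerBlDr; apply/andP; split.
  by apply: le_trans hAB _; rewrite lerD2l.
by apply: le_trans hBA _; rewrite lerD2l.
Qed.

Lemma compact_onorm_ball (r : R) : compact [set A : 'M[C]_d | onorm A <= r].
Proof.
have cl : closed [set A : 'M[C]_d | onorm A <= r].
  rewrite (_ : [set _ | _] = @onorm R d @^-1` [set x | x <= r]) //.
  by apply: preimage_closed => [A _|]; [exact: onorm_continuous|exact: closed_le].
apply: subclosed_compact cl (@compact_mx_entries d d r) _.
move=> A hA i j; have := le_trans (normc_le_onorm A i j) hA.
case: (A i j) => a b /= hab; split; apply: le_trans hab;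
  rewrite -sqrtr_sqr ler_sqrt ?addr_ge0 ?sqr_ge0 //.
- by rewrite lerDl sqr_ge0.
- by rewrite lerDr sqr_ge0.
Qed.

Lemma compact_onorm_sphere : compact [set A : 'M[C]_d | onorm A = 1].
Proof.
have cl : closed [set A : 'M[C]_d | onorm A = 1].
  rewrite (_ : [set _ | _] = @onorm R d @^-1` [set x | x = 1]) //.
  by apply: preimage_closed => [A _|]; [exact: onorm_continuous|exact: closed_eq].
have cb := @compact_onorm_ball 1.
apply: (subclosed_compact cl cb) => A /= ->.
exact: lexx.
Qed.

End MatrixTopology.

(** * Borel measurability of matrix products *)

Section MatrixMeasurability.
Context {R : realType} {d : nat}.
Local Notation C := R[i].
Local Notation M := 'M[C]_d.
Local Notation normc := (@Normc.normc R).

Lemma normc_le_ReIm (z : C) : normc z <= `|complex.Re z| + `|complex.Im z|.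
Proof.
have -> : z = (complex.Re z)%:C%C + Complex 0 (complex.Im z).
  by case: z => a b; apply/eqP; rewrite eq_complex /= addr0 add0r !eqxx.
apply: le_trans (le_normcD _ _) _.
by rewrite /Normc.normc /= !expr0n /= !addr0 !add0r !sqrtr_sqr.
Qed.

Lemma open_measurable_mx (U : set M) : open U -> measurable U.
Proof. by move=> oU; apply: sub_sigma_algebra. Qed.

Lemma continuous_measurable_mx (f : M -> R) : continuous f -> measurable_fun setT f.
Proof.
move=> cf; apply: (measurability _ (RGenOpens.measurableE R)).
move=> _ [_ [x [y ->]] <-]; rewrite setTI; apply: open_measurable_mx.
by move/continuousP : cf; apply; exact: interval_open.
Qed.

Let box (u : 'M[rat * rat]_d * nat) : set M :=
  [set X | forall i j,
     `|complex.Re (X i j) - ratr (u.1 i j).1| < u.2.+1%:R^-1 /\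
     `|complex.Im (X i j) - ratr (u.1 i j).2| < u.2.+1%:R^-1].

Let rat_approx (x e : R) : 0 < e -> exists q : rat, `|x - ratr q| < e.
Proof.
move=> e0; have [|q] := @rat_in_itvoo R (x - e) (x + e).
  by rewrite ltrBlDr -addrA ltrDl addr_gt0.
by rewrite in_itv /= => hq; exists q; rewrite ltr_distlC.
Qed.

Let open_box (U : set M) : open U -> U = \bigcup_(u in [set u | box u `<=` U]) box u.
Proof.
move=> oU; apply/seteqP; split => [X UX|X [u hu Xu]]; last exact: hu.
have /nbhs_mxP [e e0 eU] : nbhs X U by exact: open_nbhs_nbhs.
pose n := Num.truncn (4 / e).
(* A quarter of [e], because the real and the imaginary part are each compared through a rational
   centre, with two errors apiece. *)
have n4 : n.+1%:R^-1 < e / 4 :> R.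
  by rewrite invf_plt ?posrE ?divr_gt0 // invf_div truncnS_gt.
have n0 : 0 < n.+1%:R^-1 :> R by rewrite invr_gt0.
have /choice [Q hQ] : forall p : 'I_d * 'I_d, exists q : rat * rat,
    `|complex.Re (X p.1 p.2) - ratr q.1| < n.+1%:R^-1 /\
    `|complex.Im (X p.1 p.2) - ratr q.2| < n.+1%:R^-1.
  move=> p; have [a ha] := rat_approx (complex.Re (X p.1 p.2)) n0.
  have [b hb] := rat_approx (complex.Im (X p.1 p.2)) n0.
  by exists (a, b).
exists (\matrix_(i, j) Q (i, j), n) => [Y hY|i j]; last first.
  by rewrite /= mxE; exact: (hQ (i, j)).
apply: eU => i j; have [/= a1 b1] := hQ (i, j).
have := hY i j; rewrite /= mxE => -[a2 b2].
apply: le_lt_trans (normc_le_ReIm _) _.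
have a3 : `|complex.Re (Y i j - X i j)| < e / 2.
  rewrite raddfB /= (le_lt_trans (ler_distD (ratr (Q (i, j)).1) _ _)) //.
  rewrite (distrC (ratr _)) [e / 2](_ : _ = e / 4 + e / 4); last by field.
  by rewrite ltrD // (lt_trans _ n4).
have b3 : `|complex.Im (Y i j - X i j)| < e / 2.
  rewrite raddfB /= (le_lt_trans (ler_distD (ratr (Q (i, j)).2) _ _)) //.
  rewrite (distrC (ratr _)) [e / 2](_ : _ = e / 4 + e / 4); last by field.
  by rewrite ltrD // (lt_trans _ n4).
by rewrite [e]splitr ltrD.
Qed.

(** On pairs of matrices the sigma-algebra is the product one, so continuity of the product does not
    give its measurability at once. Open sets are unions of boxes with rational centres and radii;
    this family is countable, which reduces measurability to that of the entries. *)
Lemma measurable_fun_mx disp (T : measurableType disp) (f : T -> M) :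
  (forall i j, measurable_fun setT (fun t => complex.Re (f t i j))) ->
  (forall i j, measurable_fun setT (fun t => complex.Im (f t i j))) ->
  measurable_fun setT f.
Proof.
move=> mRe mIm; apply: (@measurability _ _ _ _ _ _ (@open M)) => //.
move=> _ [U oU <-]; rewrite setTI (open_box oU) preimage_bigcup bigcup_mkcond.
apply: countable_bigcupT_measurable => [|u]; first exact: countableP.
case: ifP => // _.
have -> : f @^-1` box u = \bigcap_(p in [set: 'I_d * 'I_d])
    ((fun t => complex.Re (f t p.1 p.2) - ratr (u.1 p.1 p.2).1) @^-1`
       ball 0 u.2.+1%:R^-1 `&`
     (fun t => complex.Im (f t p.1 p.2) - ratr (u.1 p.1 p.2).2) @^-1`
       ball 0 u.2.+1%:R^-1).
  apply/seteqP; split => [t ht p _|t ht i j].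
    by have [] := ht p.1 p.2; split; rewrite /ball /= sub0r normrN.
  by have [] := ht (i, j) I; rewrite /ball /= !sub0r !normrN.
apply: fin_bigcap_measurable => // p _; apply: measurableI.
- rewrite -[X in measurable X]setTI; apply: measurable_funB => //.
  exact: measurable_ball.
- rewrite -[X in measurable X]setTI; apply: measurable_funB => //.
  exact: measurable_ball.
Qed.

Lemma measurable_Re_entry i j : measurable_fun setT (fun X : M => complex.Re (X i j)).
Proof.
apply: continuous_measurable_mx => A; apply: continuous_onormP => e e0.
exists e => // B; apply: le_lt_trans; rewrite -raddfB.
have := normc_le_onorm (B - A) i j; rewrite !mxE; apply: le_trans.
case: (B i j - A i j) => a b /=.
by rewrite -sqrtr_sqr ler_sqrt ?addr_ge0 ?sqr_ge0 // lerDl sqr_ge0.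
Qed.

Lemma measurable_Im_entry i j : measurable_fun setT (fun X : M => complex.Im (X i j)).
Proof.
apply: continuous_measurable_mx => A; apply: continuous_onormP => e e0.
exists e => // B; apply: le_lt_trans; rewrite -raddfB.
have := normc_le_onorm (B - A) i j; rewrite !mxE; apply: le_trans.
case: (B i j - A i j) => a b /=.
by rewrite -sqrtr_sqr ler_sqrt ?addr_ge0 ?sqr_ge0 // lerDr sqr_ge0.
Qed.

Lemma measurable_mulmx disp (T : measurableType disp) (f g : T -> M) :
  measurable_fun setT f -> measurable_fun setT g ->
  measurable_fun setT (fun t => f t *m g t).
Proof.
move=> mf mg.
have mR (h : T -> M) : measurable_fun setT h -> forall i j,
    measurable_fun setT (fun t : T => complex.Re (h t i j)).
  by move=> mh i j; apply: (measurableT_comp (measurable_Re_entry i j)).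
have mI (h : T -> M) : measurable_fun setT h -> forall i j,
    measurable_fun setT (fun t : T => complex.Im (h t i j)).
  by move=> mh i j; apply: (measurableT_comp (measurable_Im_entry i j)).
apply: measurable_fun_mx => i j.
- have -> : (fun t => complex.Re ((f t *m g t) i j)) = (fun t => \sum_k
      (complex.Re (f t i k) * complex.Re (g t k j) -
       complex.Im (f t i k) * complex.Im (g t k j))).
    apply/funext => t; rewrite mxE Re_sum; apply: eq_bigr => k _.
    by case: (f t i k) (g t k j) => a b [a' b'].
  apply: measurable_sum => k; apply: measurable_funB; apply: measurable_funM;
    by [exact: mR|exact: mI].
- have -> : (fun t => complex.Im ((f t *m g t) i j)) = (fun t => \sum_k
      (complex.Re (f t i k) * complex.Im (g t k j) +
       complex.Im (f t i k) * complex.Re (g t k j))).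
    apply/funext => t; rewrite mxE.
    rewrite (big_morph (@complex.Im R) (fun x y => raddfD _ x y) (erefl _)).
    apply: eq_bigr => k _.
    by case: (f t i k) (g t k j) => a b [a' b'].
  apply: measurable_sum => k; apply: measurable_funD; apply: measurable_funM;
    by [exact: mR|exact: mI].
Qed.

Lemma mx_prod_cons n (x : M) (t : n.-tuple M) :
  mx_prod [tuple of x :: t] = mx_prod t *m x.
Proof.
rewrite /mx_prod /= mulmx1; move: (val t) => l {t}.
elim/last_ind : l => [|l v IHl] /=; first by rewrite mul1mx.
by rewrite !foldl_rcons IHl mulmxA.
Qed.

Lemma measurable_mx_prod n : measurable_fun setT (@mx_prod R d n).
Proof.
elim: n => [|n IH].
  have -> : @mx_prod R d 0 = cst 1%:M by apply/funext => t; rewrite (tuple0 t).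
  exact: measurable_cst.
have -> : @mx_prod R d n.+1 =
    (fun t => mx_prod [tuple of behead t] *m tnth t ord0).
  apply/funext => t; case/tupleP : t => x t.
  have -> : [tuple of behead [tuple of x :: t]] = t by apply/val_inj.
  by rewrite tnth0 mx_prod_cons.
apply: measurable_mulmx; last exact: measurable_tnth.
by apply: measurableT_comp IH _; exact: measurable_behead.
Qed.

End MatrixMeasurability.

(** * The transfer operator and random products *)

Section SigmaFinitePacking.
Context d (T : measurableType d) (R : realType).

(** An alias on which sigma-finiteness, known only through the proof [sm], can be declared as a
    structure. *)
Definition sigma_finite_copy (m : {measure set T -> \bar R})
  (sm : sigma_finite setT m) : set T -> \bar R := m.

HB.instance Definition _ (m : {measure set T -> \bar R}) (sm : sigma_finite setT m) :=
  Measure.on (sigma_finite_copy sm).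
HB.instance Definition _ (m : {measure set T -> \bar R}) (sm : sigma_finite setT m) :=
  Measure_isSigmaFinite.Build _ _ _ (sigma_finite_copy sm) sm.

End SigmaFinitePacking.

Lemma measure_pushforward_pack d (T : measurableType d) (R : realType)
    d' (T' : measurableType d') (f : T -> T')
    (m : {measure set T -> \bar R}) : measurable_fun setT f ->
  exists m' : {measure set T' -> \bar R}, m' = pushforward m f :> (set T' -> \bar R).
Proof.
by move=> mf; unshelve eexists (pushforward m f : {measure set T' -> \bar R}).
Qed.

Section Transfer.
Context {R : realType} {d : nat}.
Local Notation M := 'M[R[i]]_d.
Local Open Scope ereal_scope.

Definition transfer (mu : set M -> \bar R) (f : M -> \bar R) (A : M) : \bar R :=
  \int[mu]_v f (v *m A).

Variable mu : {sigma_finite_measure set M -> \bar R}.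
Local Notation P := (transfer mu).
Implicit Types f g : M -> \bar R.

Lemma measurable_mulmxr (A : M) : measurable_fun setT (fun v : M => v *m A).
Proof. by apply: measurable_mulmx => //; exact: measurable_cst. Qed.

Lemma measurable_comp_mulmxr f (A : M) : measurable_fun setT f ->
  measurable_fun setT (fun v => f (v *m A)).
Proof. by move=> mf; apply: measurableT_comp mf (measurable_mulmxr A). Qed.

Lemma transfer_ge0 f : (forall A, 0 <= f A) -> forall A, 0 <= P f A.
Proof. by move=> f0 A; apply: integral_ge0. Qed.

Lemma measurable_transfer f : (forall A, 0 <= f A) -> measurable_fun setT f ->
  measurable_fun setT (P f).
Proof.
move=> f0 mf.
apply: (@measurable_fun_fubini_tonelli_G _ _ _ _ R mu (fun p : M * M => f (p.1 *m p.2))) => //.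
by apply: measurableT_comp mf _; exact: measurable_mulmx.
Qed.

Lemma iter_transfer_ge0 n f : (forall A, 0 <= f A) ->
  forall A, 0 <= iter n P f A.
Proof. by move=> f0; elim: n => //= n IH; exact: transfer_ge0. Qed.

Lemma measurable_iter_transfer n f : (forall A, 0 <= f A) ->
  measurable_fun setT f -> measurable_fun setT (iter n P f).
Proof.
move=> f0 mf; elim: n => //= n IH; apply: measurable_transfer => //.
exact: iter_transfer_ge0.
Qed.

Lemma transfer_le f g : (forall A, 0 <= f A) -> measurable_fun setT f ->
  measurable_fun setT g -> (forall A, f A <= g A) -> forall A, P f A <= P g A.
Proof.
move=> f0 mf mg fg A.
by apply: ge0_le_integral => //; exact: measurable_comp_mulmxr.
Qed.

Lemma iter_transfer_le n f g : (forall A, 0 <= f A) -> measurable_fun setT f ->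
  measurable_fun setT g -> (forall A, f A <= g A) ->
  forall A, iter n P f A <= iter n P g A.
Proof.
move=> f0 mf mg fg; have g0 A : 0 <= g A by exact: le_trans (f0 A) (fg A).
elim: n => //= n IH; apply: transfer_le => //.
- exact: iter_transfer_ge0.
- exact: measurable_iter_transfer.
- exact: measurable_iter_transfer.
Qed.

Lemma iter_transferZ n c f : (0 <= c)%R -> (forall A, 0 <= f A) ->
  measurable_fun setT f ->
  forall A, iter n P (fun B => c%:E * f B) A = c%:E * iter n P f A.
Proof.
move=> c0 f0 mf; elim: n => //= n IH A; rewrite /transfer.
under eq_integral do rewrite IH.
rewrite ge0_integralZl_EFin //; first by move=> v _; exact: iter_transfer_ge0.
by apply: measurable_comp_mulmxr; exact: measurable_iter_transfer.
Qed.

Lemma iter_transferD n f g : (forall A, 0 <= f A) -> (forall A, 0 <= g A) ->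
  measurable_fun setT f -> measurable_fun setT g ->
  forall A, iter n P (fun B => f B + g B) A = iter n P f A + iter n P g A.
Proof.
move=> f0 g0 mf mg; elim: n => //= n IH A; rewrite /transfer.
under eq_integral do rewrite IH.
rewrite ge0_integralD //.
- by move=> v _; exact: iter_transfer_ge0.
- by apply: measurable_comp_mulmxr; exact: measurable_iter_transfer.
- by move=> v _; exact: iter_transfer_ge0.
- by apply: measurable_comp_mulmxr; exact: measurable_iter_transfer.
Qed.

Lemma iter_transfer_sum n (I : Type) (r : seq I) (f : I -> M -> \bar R) :
  (forall i A, 0 <= f i A) -> (forall i, measurable_fun setT (f i)) ->
  forall A, iter n P (fun B => \sum_(i <- r) f i B) A =
            \sum_(i <- r) iter n P (f i) A.
Proof.
move=> f0 mf A; elim: r => [|i r IH].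
  rewrite big_nil; under eq_fun do rewrite big_nil.
  elim: n A => //= n IH A; rewrite /transfer.
  by under eq_integral do rewrite IH; rewrite integral0.
under eq_fun do rewrite big_cons.
rewrite iter_transferD ?big_cons ?IH //.
- by move=> B; apply: sume_ge0.
- exact: emeasurable_sum.
Qed.

(** Left and right multiplication commute. A value of an iterate at [A] thus becomes a value at the
    identity, and inequalities between values at different points reduce to pointwise ones in the
    left factor. *)
Lemma iter_transfer_mulmxr n f (A B : M) :
  iter n P (fun X => f (X *m A)) B = iter n P f (B *m A).
Proof.
elim: n B => //= n IH B; apply: eq_integral => v _.
by rewrite IH mulmxA.
Qed.

End Transfer.

Section PowMeasure.
Context {R : realType} {d : nat}.
Local Notation M := 'M[R[i]]_d.
Local Open Scope ereal_scope.
Variable mu : {sigma_finite_measure set M -> \bar R}.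

Let cons_tuple n (p : M * n.-tuple M) : n.+1.-tuple M := [tuple of p.1 :: p.2].

Let measurable_cons_tuple n : measurable_fun setT (@cons_tuple n).
Proof. exact: measurable_cons. Qed.

(** [pow_measure] is a bare set function, while Tonelli needs a sigma-finite measure at each step of
    the induction. The exhausting sets are cylinders over [F k] and [G k]; both sequences increase,
    so the larger of two indices serves head and tail together. *)
Lemma pow_measure_sigma_finite n :
  exists nu : {sigma_finite_measure set (n.-tuple M) -> \bar R},
    pow_measure mu n = nu.
Proof.
elim: n => [|n [nu nuE]].
  by exists (dirac ([tuple] : 0.-tuple M)).
have [m mE] := measure_pushforward_pack (mu \x nu) (@measurable_cons_tuple n).
have mpow : m = pow_measure mu n.+1 :> (set _ -> _).
  by rewrite mE /= nuE.
suff sm : sigma_finite setT m.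
  by exists (sigma_finite_copy sm).
have /sigma_finiteP[F [FT ndF mF]] := sigma_finiteT mu.
have /sigma_finiteP[G [GT ndG mG]] := sigma_finiteT nu.
pose hd (t : n.+1.-tuple M) := tnth t ord0.
pose tl (t : n.+1.-tuple M) := [tuple of behead t] : n.-tuple M.
have mhd : measurable_fun setT hd by exact: measurable_tnth.
have mtl : measurable_fun setT tl by exact: measurable_behead.
exists (fun k => hd @^-1` F k `&` tl @^-1` G k).
  apply/seteqP; split => // t _.
  have : [set: M] (hd t) by []. have : [set: n.-tuple M] (tl t) by [].
  rewrite FT GT => -[k _ Gk] [l _ Fl]; exists (maxn k l) => //; split => /=.
    by move: (hd t) Fl; exact/subsetPset/ndF/leq_maxr.
  by move: (tl t) Gk; exact/subsetPset/ndG/leq_maxl.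
move=> k; have [mFk Fk] := mF k; have [mGk Gk] := mG k; split.
  by apply: measurableI; rewrite -[X in measurable X]setTI; [exact: mhd|exact: mtl].
have pre : @cons_tuple n @^-1` (hd @^-1` F k `&` tl @^-1` G k) = F k `*` G k.
  apply/seteqP; split => -[x t] [] /=; rewrite /hd /tl tnth0 => Fx Gt; split => //=.
    by rewrite [t](_ : _ = [tuple of behead (x :: t)]) //; exact/val_inj.
  by rewrite (_ : [tuple of _] = t) //; exact/val_inj.
rewrite mE /pushforward pre (_ : _ (_ `*` _) = mu (F k) * nu (G k)).
  by rewrite lte_mul_pinfty // ge0_fin_numE.
exact: product_measure1E.
Qed.

(** The head of a tuple is the rightmost factor, so integrating over it replaces [A] by [v *m A];
    the free right factor [A] is what lets the induction go through. *)
Lemma integral_pow_measure n (f : M -> \bar R) (A : M) :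
  (forall B, 0 <= f B) -> measurable_fun setT f ->
  \int[pow_measure mu n]_t f (mx_prod t *m A) = iter n (transfer mu) f A.
Proof.
move=> f0 mf; elim: n A => [|n IH] A.
  rewrite [LHS](_ : _ = \int[\d_([tuple] : 0.-tuple M)]_t f (mx_prod t *m A)) //.
  rewrite integral_dirac // ?diracT ?mul1e ?mul1mx //.
  apply: measurableT_comp mf _; apply: measurable_mulmx (measurable_cst _).
  exact: measurable_mx_prod.
have [nu nuE] := pow_measure_sigma_finite n.
have mF : measurable_fun setT (fun t : n.+1.-tuple M => f (mx_prod t *m A)).
  apply: measurableT_comp mf _; apply: measurable_mulmx (measurable_cst _).
  exact: measurable_mx_prod.
rewrite [LHS](_ : _ = \int[pushforward (mu \x nu) (@cons_tuple n)]_t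
    f (mx_prod t *m A)); last by rewrite /= nuE.
rewrite (ge0_integral_pushforward (@measurable_cons_tuple n)) //.
rewrite [X in integral _ X _](_ : _ = setT) // fubini_tonelli1 //=; last first.
  exact: measurableT_comp mF (@measurable_cons_tuple n).
apply: eq_integral => v _; rewrite /fubini_F -IH nuE.
by apply: eq_integral => t _; rewrite /= mx_prod_cons mulmxA.
Qed.

End PowMeasure.

(** * The semigroup generated by the support, and irreducibility *)

Section Semigroup.
Context {R : realType} {d : nat}.
Local Notation M := 'M[R[i]]_d.
Variable mu : set M -> \bar R.
Local Notation T := (mx_semigroup mu).

Lemma mx_semigroup1 : T 1%:M.
Proof. by exists 0%N, [tuple]; split=> [[]|]. Qed.

Lemma mx_semigroup_cons a v : T a -> msupp mu v -> T (a *m v).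
Proof.
move=> [n [t [ht ->]]] hv; exists n.+1, [tuple of v :: t]; split.
  by move=> i; case: (unliftP ord0 i) => [j|] ->; rewrite ?tnth0 ?tnthS.
by rewrite mx_prod_cons.
Qed.

Lemma mx_semigroup_ind (Q : M -> Prop) : Q 1%:M ->
  (forall a v, T a -> Q a -> msupp mu v -> Q (a *m v)) -> forall a, T a -> Q a.
Proof.
move=> Q1 QM a [n [t [ht ->]]]; elim: n t ht => [|n IH] t ht.
  by rewrite (tuple0 t).
case/tupleP : t ht => v t ht.
have ht' i : msupp mu (tnth t i) by have := ht (lift ord0 i); rewrite tnthS.
rewrite mx_prod_cons; apply: QM; last by have := ht ord0; rewrite tnth0.
- by exists n, t.
- exact: IH.
Qed.

Lemma mx_semigroupM a b : T a -> T b -> T (a *m b).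
Proof.
move=> Ta; apply: (mx_semigroup_ind (Q := fun b => T (a *m b))).
  by rewrite mulmx1.
by move=> c v _ Tac hv; rewrite mulmxA; exact: mx_semigroup_cons.
Qed.

Lemma msupp_semigroup v : msupp mu v -> T v.
Proof. by move=> hv; rewrite -(mul1mx v); apply: mx_semigroup_cons mx_semigroup1 _. Qed.

Hypothesis mu_irr : mx_irreducible mu.

(** Take a finite part of the orbit whose span [F] has the largest dimension. Adding one more orbit
    vector cannot enlarge [F], so [F] contains the whole orbit; it is then stable under the support,
    and nonzero because it contains [x]. *)
Lemma irreducible_orbit_span (x : 'cV[R[i]]_d) : x != 0 ->
  exists (q : nat) (a : 'I_q -> M),
    (forall l, T (a l)) /\ (<<[seq a l *m x | l <- enum 'I_q]>> = fullv)%VS.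
Proof.
move=> x0.
pose D k := exists s : seq M, (forall a, a \in s -> T a) /\
  \dim <<[seq a *m x | a <- s]>> = k.
have D0 : exists k, `[< D k >].
  exists 0%N; apply/asboolP; exists [::]; split => //=.
  by rewrite span_nil dimv0.
have Dle k : `[< D k >] -> (k <= \dim (fullv : {vspace 'cV[R[i]]_d}))%N.
  by move=> /asboolP [s [_ <-]]; apply: dimvS; exact: subvf.
case: (ex_maxnP D0 Dle) => k /asboolP [s [sT sk]] kmax.
pose F := <<[seq a *m x | a <- s]>>%VS.
have TF a : T a -> a *m x \in F.
  move=> Ta; have hsub : (F <= <<[seq b *m x | b <- a :: s]>>)%VS.
    by rewrite /= span_cons addvSr.
  have /eqP -> : F == <<[seq b *m x | b <- a :: s]>>%VS.
    rewrite eqEdim hsub /= sk; apply: kmax; apply/asboolP.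
    exists (a :: s); split => // b; rewrite inE => /orP[/eqP ->//|]; exact: sT.
  by rewrite /= span_cons; apply: (subvP (addvSl _ _)); exact: memv_line.
have FT : F = fullv.
  apply: contrapT => FnT; apply: mu_irr; exists F; split.
  - apply/eqP => F0; have := TF _ mx_semigroup1; rewrite F0 memv0 mul1mx.
    by move/eqP: x0 => + /eqP.
  - exact/eqP.
  - move=> v hv y yF.
    rewrite (@coord_span _ _ _ (in_tuple [seq a *m x | a <- s]) y yF) mulmx_sumr rpred_sum // => i _.
    rewrite -scalemxAr rpredZ //.
    have is_s : (i < size s)%N by rewrite -(size_map (mulmx^~ x)); exact: ltn_ord.
    rewrite (nth_map 0) // mulmxA; apply: TF; apply: mx_semigroupM.
      exact: msupp_semigroup.
    by apply: sT; exact: mem_nth.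
exists (size s), (fun l => nth 0 s l); split => [l|].
  by apply: sT; exact: mem_nth.
rewrite -FT /F; congr span.
rewrite (map_comp (fun a => a *m x) (fun l : 'I__ => nth 0 s l)); congr map.
by rewrite (map_comp (nth 0 s) val) val_enum_ord map_nth_iota0 // take_size.
Qed.

(** Irreducibility as a matrix identity. A nonzero column [j] of [A] has a spanning orbit; writing
    the basis vectors in it with coefficients [c l i] gives the identity with [b l] equal to the
    [j]-th basis column times the row of these coefficients. *)
Lemma irreducible_resolution (A : M) : A != 0 ->
  exists (q : nat) (a b : 'I_q -> M),
    (forall l, T (a l)) /\ \sum_l a l *m A *m b l = 1%:M.
Proof.
move=> A0.
have [j Aj] : exists j, col j A != 0.
  apply: contrapT => h; move/eqP: A0; apply; apply/matrixP => i j.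
  have : col j A = 0 by apply: contrapT => /eqP ?; apply: h; exists j.
  by move/matrixP => /(_ i 0); rewrite !mxE.
have [q [a [aT aF]]] := irreducible_orbit_span Aj.
pose X := [tuple of [seq a l *m col j A | l <- enum 'I_q]].
pose c l i := coord X l (delta_mx i 0 : 'cV[R[i]]_d).
have sX : #|'I_q| = q := card_ord q.
exists q, a, (fun l => delta_mx j 0 *m \row_i c (cast_ord (esym sX) l) i); split => //.
apply/matrixP => i k; rewrite summxE.
have : (delta_mx k 0 : 'cV[R[i]]_d) \in <<X>>%VS by rewrite aF memvf.
move/coord_span/matrixP => /(_ i 0); rewrite mxE summxE eqxx andbT => E.
rewrite mxE E (reindex (cast_ord sX)) /=; last first.
  by exists (cast_ord (esym sX)) => l _; rewrite ?cast_ordK ?cast_ordKV.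
apply: eq_bigr => l _; apply/esym; rewrite [in LHS]mxE -/(c _ _).
have lq : (l < q)%N := ltn_ord (cast_ord sX l).
rewrite (nth_map (cast_ord sX l)) ?size_enum_ord //.
have -> : nth (cast_ord sX l) (enum 'I_q) l = cast_ord sX l.
  by apply/val_inj; rewrite /= nth_enum_ord.
rewrite cast_ordK; set r := \row_ _ _.
have -> : a (cast_ord sX l) *m A *m (delta_mx j 0 *m r) =
    a (cast_ord sX l) *m col j A *m r by rewrite colE !mulmxA.
by rewrite [RHS]mxE big_ord1 [r 0 k]mxE mulrC.
Qed.

End Semigroup.

(** * Homogeneous functions and the maximum principle *)

Section Homogeneous.
Context {R : realType} {d : nat}.
Local Notation M := 'M[R[i]]_d.

(** Monotonicity of the powers with exponents [r] and [r^-1]: the neighbourhood of [x] is the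
    preimage of the interval of radius [e] around [u]. If [u < e] the lower bound is automatic,
    which covers [x = 0]. *)
Lemma powR_near (r x e : R) : 0 < r -> 0 <= x -> 0 < e ->
  exists2 k : R, 0 < k & forall y, 0 <= y -> `|y - x| < k -> `|y `^ r - x `^ r| < e.
Proof.
move=> r0 x0 e0.
have r1 : 0 < r^-1 by rewrite invr_gt0.
have powK z : 0 <= z -> (z `^ r) `^ r^-1 = z.
  by move=> z0; rewrite -powRrM divff ?gt_eqF // powRr1.
have powVK z : 0 <= z -> (z `^ r^-1) `^ r = z.
  by move=> z0; rewrite -powRrM mulVf ?gt_eqF // powRr1.
pose u := x `^ r; have u0 : 0 <= u by exact: powR_ge0.
have xu : x < (u + e) `^ r^-1.
  rewrite -{1}(powK x x0) -/u; apply: gt0_ltr_powR => //; rewrite ?nnegrE ?ltrDl //.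
  by rewrite addr_ge0 // ltW.
have [ue|ue] := ltP u e.
  exists ((u + e) `^ r^-1 - x) => [|y y0]; first by rewrite subr_gt0.
  rewrite ltr_distl => /andP[_]; rewrite addrCA subrr addr0 => hy.
  have : y `^ r < u + e.
    rewrite -[X in _ < X]powVK; last by rewrite addr_ge0 // ltW.
    by apply: gt0_ltr_powR; rewrite ?nnegrE ?powR_ge0.
  rewrite ltr_distl -/u => ->; rewrite andbT (lt_le_trans _ (powR_ge0 _ _)) //.
  by rewrite subr_lt0.
have ux : (u - e) `^ r^-1 < x.
  rewrite -[X in _ < X](powK x x0) -/u; apply: gt0_ltr_powR => //.
  - by rewrite nnegrE subr_ge0.
  - by rewrite ltrBlDr ltrDl.
exists (Num.min ((u + e) `^ r^-1 - x) (x - (u - e) `^ r^-1)).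
  by rewrite lt_min !subr_gt0 xu ux.
move=> y y0; rewrite lt_min => /andP[].
rewrite ltr_distl => /andP[_]; rewrite addrCA subrr addr0 => hy.
rewrite ltr_distl => /andP[+ _]; rewrite subKr => hy'.
rewrite ltr_distl -/u; apply/andP; split.
  rewrite -[X in X < _]powVK ?subr_ge0 //.
  by apply: gt0_ltr_powR; rewrite ?nnegrE ?powR_ge0.
rewrite -[X in _ < X]powVK; last by rewrite addr_ge0 // ltW.
by apply: gt0_ltr_powR; rewrite ?nnegrE ?powR_ge0.
Qed.

Lemma continuous_powR (T : topologicalType) (f : T -> R) r : 0 < r ->
  (forall x, 0 <= f x) -> continuous f -> continuous (fun x => f x `^ r).
Proof.
move=> r0 f0 cf x; apply/cvgrPdist_lt => e e0.
have [k k0 hk] := powR_near r0 (f0 x) e0.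
near=> y; rewrite distrC; apply: hk => //; rewrite distrC.
by near: y; have /cvgrPdist_lt := cf x; apply.
Unshelve. all: by end_near. Qed.

Lemma continuousM_fun (T : topologicalType) (f g : T -> R) :
  continuous f -> continuous g -> continuous (fun x => f x * g x).
Proof. by move=> cf cg x; apply: cvgM; [exact: cf|exact: cg]. Qed.

(** Nonnegative scalars are enough to normalize to the unit sphere. Since [c = 0] is allowed, [g]
    vanishes at [0] as soon as [s] is nonzero. *)
Definition homog (s : R) (g : M -> R) : Prop :=
  forall (c : R) A, 0 <= c -> g (c%:C%C *: A) = c `^ s * g A.

Definition onorm_pow (s : R) (A : M) : R := onorm A `^ s.

Definition wedge_pow (alpha s : R) (A : M) : R :=
  wnorm A `^ alpha * onorm A `^ (s - 2 * alpha).

Lemma onorm_pow_ge0 s A : 0 <= onorm_pow s A. Proof. exact: powR_ge0. Qed.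

Lemma wedge_pow_ge0 alpha s A : 0 <= wedge_pow alpha s A.
Proof. by rewrite mulr_ge0 ?powR_ge0. Qed.

Lemma onorm_pow_continuous s : 0 < s -> continuous (onorm_pow s).
Proof.
move=> s0; apply: continuous_powR => //; first exact: onorm_ge0.
exact: onorm_continuous.
Qed.

Lemma wedge_pow_continuous alpha s : 0 < alpha -> 0 < s - 2 * alpha ->
  continuous (wedge_pow alpha s).
Proof.
move=> a0 sa; apply: continuousM_fun; apply: continuous_powR => //.
- exact: wnorm_ge0.
- exact: wnorm_continuous.
- exact: onorm_ge0.
- exact: onorm_continuous.
Qed.

Lemma homog_onorm_pow s : homog s (onorm_pow s).
Proof.
move=> c A c0; rewrite /onorm_pow onormZ normc_real //.
by rewrite powRM // onorm_ge0.
Qed.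

Lemma homog_wedge_pow alpha s : 0 < s -> homog s (wedge_pow alpha s).
Proof.
move=> s0 c A c0; rewrite /wedge_pow onormZ wnormZ normc_real //.
rewrite (powRM _ (sqr_ge0 c) (wnorm_ge0 A)) (powRM _ c0 (onorm_ge0 A)).
rewrite mulrACA; congr (_ * _).
rewrite -powR_mulrn // -powRrM -powRD; first by rewrite addrC subrK.
by rewrite addrC subrK gt_eqF.
Qed.

Lemma powR_le (r x y : R) : 0 <= r -> 0 <= x -> x <= y -> x `^ r <= y `^ r.
Proof.
by move=> r0 x0 xy; apply: ge0_ler_powR => //; rewrite nnegrE // (le_trans x0).
Qed.

Lemma wedge_pow_le alpha s A : 0 < alpha -> 0 < s ->
  wedge_pow alpha s A <= onorm_pow s A.
Proof.
move=> a0 s0; rewrite /wedge_pow /onorm_pow.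
have -> : onorm A `^ s = (onorm A ^+ 2) `^ alpha * onorm A `^ (s - 2 * alpha).
  rewrite -powR_mulrn ?onorm_ge0 // -powRrM -powRD; first by rewrite addrC subrK.
  by rewrite addrC subrK gt_eqF.
by rewrite ler_wpM2r ?powR_ge0 // powR_le ?wnorm_ge0 ?wnorm_le_sqr // ltW.
Qed.

Lemma wedge_powM alpha s A B : 0 < alpha -> 0 <= s - 2 * alpha ->
  wedge_pow alpha s (A *m B) <= wedge_pow alpha s A * wedge_pow alpha s B.
Proof.
move=> a0 s0; have := powR_le (ltW a0) (wnorm_ge0 _) (wnormM A B).
rewrite (powRM alpha (wnorm_ge0 A) (wnorm_ge0 B)) => h1.
have := powR_le s0 (onorm_ge0 _) (onormM A B).
rewrite (powRM (s - 2 * alpha) (onorm_ge0 A) (onorm_ge0 B)) => h2.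
by rewrite /wedge_pow mulrACA; apply: ler_pM => //; exact: powR_ge0.
Qed.

Lemma onorm_powM s A B : 0 <= s ->
  onorm_pow s (A *m B) <= onorm_pow s A * onorm_pow s B.
Proof.
move=> s0; have := powR_le s0 (onorm_ge0 _) (onormM A B).
by rewrite (powRM s (onorm_ge0 A) (onorm_ge0 B)).
Qed.

Lemma wedge_pow_rank1 alpha s A : alpha != 0 -> (\rank A <= 1)%N ->
  wedge_pow alpha s A = 0.
Proof. by move=> a0 rA; rewrite /wedge_pow wnorm_rank1 // powR0 // mul0r. Qed.

Lemma homog0 s g : s != 0 -> homog s g -> g 0 = 0.
Proof.
move=> s0 hg; have := hg 0 0 (lexx _).
by rewrite scaler0 powR0 // mul0r.
Qed.

Lemma mulmx_near (S0 A : M) (k : R) : 0 < k ->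
  exists2 e : R, 0 < e & forall S B, onorm (S - S0) < e -> onorm (B - A) < e ->
    onorm (S *m B - S0 *m A) < k.
Proof.
move=> k0; pose D := onorm S0 + onorm A + 2.
have D0 : 0 < D by rewrite ltr_wpDl // addr_ge0 // onorm_ge0.
have kD : 0 < k / D by rewrite divr_gt0.
have [e [e0 e1 ek]] : exists e : R, [/\ 0 < e, e <= 1 & e <= k / D].
  exists (Num.min 1 (k / D)).
  by rewrite lt_min ltr01 kD /= ge_min lexx /= ge_min lexx orbT.
exists e => // S B Se Be.
have S1 := lt_le_trans Se e1.
have {}Se := lt_le_trans Se ek; have {}Be := lt_le_trans Be ek.
have -> : S *m B - S0 *m A = S *m (B - A) + (S - S0) *m A.
  by rewrite mulmxBr mulmxBl subrKA.
have hS : onorm S <= onorm S0 + 1.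
  have := onormD (S - S0) S0; rewrite subrK => /le_trans; apply.
  by rewrite [leLHS]addrC lerD2l; exact: ltW S1.
have kD0 : 0 <= k / D by exact: ltW.
apply: (@le_lt_trans _ _ ((onorm S0 + 1) * (k / D) + (k / D) * onorm A)).
  apply: le_trans (onormD _ _) _; apply: lerD; apply: le_trans (onormM _ _) _.
    by apply: ler_pM; [exact: onorm_ge0|exact: onorm_ge0|exact: hS|exact: ltW].
  by apply: ler_wpM2r; [exact: onorm_ge0|exact: ltW].
rewrite /D in D0 *; move: (onorm S0) (onorm A) D0 => a b D0.
rewrite mulrC -mulrDr -mulrA gtr_pMr // mulrC ltr_pdivrMr // mul1r.
by rewrite addrAC ltrD2l (ltr_nat R 1 2).
Qed.

(** For [S] in the unit ball this is compactness; homogeneity in [S] then yields the factor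
    [onorm_pow s S]. Being uniform in [S], the estimate can be integrated over products of any
    length, which makes all normalized iterates equicontinuous. *)
Lemma mulmx_equicontinuous s g A e : 0 < s -> continuous g -> homog s g -> 0 < e ->
  exists2 k : R, 0 < k & forall B, onorm (B - A) < k ->
    forall S, `|g (S *m B) - g (S *m A)| <= e * onorm_pow s S.
Proof.
move=> s0 cg hg e0.
have /compact_near_coveringP cK := @compact_onorm_ball R d 1.
have : \forall B \near A, [set S : M | onorm S <= 1] `<=`
    (fun S => `|g (S *m B) - g (S *m A)| < e).
  apply: (cK _ (nbhs A) (fun B S => `|g (S *m B) - g (S *m A)| < e)).
  move=> S0 _.
  have /cvgrPdist_lt/(_ (e / 2)) := cg (S0 *m A).
  rewrite divr_gt0 // => /(_ isT) /nbhs_onormP [k k0 hk].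
  have [h h0 hh] := mulmx_near S0 A k0.
  exists ([set S | onorm (S - S0) < h], [set B | onorm (B - A) < h]).
    by split; apply/nbhs_onormP; exists h.
  move=> [S B] /= [hS hB].
  have h1 := hk _ (hh _ _ hS hB).
  have h2 : `|g (S0 *m A) - g (S *m A)| < e / 2.
    by apply/hk/hh => //; rewrite subrr onorm0.
  apply: (le_lt_trans (ler_distD (g (S0 *m A)) _ _)).
  by rewrite [e]splitr ltrD // distrC.
move=> /nbhs_onormP [k k0 hk]; exists k => // B hB S.
have [S0|S0] := eqVneq S 0.
  by rewrite S0 !mul0mx subrr normr0 mulr_ge0 ?powR_ge0 // ltW.
have nS : 0 < onorm S by rewrite onorm_gt0.
pose S1 := ((onorm S)^-1)%:C%C *: S.
have SE : S = (onorm S)%:C%C *: S1.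
  by rewrite scalerA -rmorphM /= divff ?gt_eqF // scale1r.
have S1n : onorm S1 <= 1.
  by rewrite onormZ normc_real ?invr_ge0 ?onorm_ge0 // mulVf // gt_eqF.
have gS X : g (S *m X) = onorm_pow s S * g (S1 *m X).
  by rewrite {1}SE -scalemxAl hg ?onorm_ge0.
have -> : g (S *m B) - g (S *m A) = onorm_pow s S * (g (S1 *m B) - g (S1 *m A)).
  by rewrite !gS mulrBr.
rewrite normrM ger0_norm ?powR_ge0 // mulrC ler_wpM2r ?powR_ge0 //.
by apply: ltW; exact: hk hB _ S1n.
Qed.

End Homogeneous.

Lemma integral_ge_on d (T : measurableType d) (R : realType)
    (mu : {measure set T -> \bar R}) (U : set T) (g : T -> \bar R) (t : R) :
  measurable U -> measurable_fun setT g -> (forall x, 0 <= g x)%E -> 0 <= t ->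
  (forall x, U x -> t%:E <= g x)%E -> (t%:E * mu U <= \int[mu]_x g x)%E.
Proof.
move=> mU mg g0 t0 tg; rewrite -integral_cst //.
apply: (@le_trans _ _ (\int[mu]_(x in U) g x)%E).
  by apply: ge0_le_integral => //; exact: measurable_funS mg.
exact: ge0_subset_integral.
Qed.

Lemma continuous_mulB (T : topologicalType) (R : realType) (r : R) (f g : T -> R) :
  continuous f -> continuous g -> continuous (fun x => r * f x - g x).
Proof.
move=> cf cg x; apply: cvgB; last exact: cg.
by apply: cvgM; [exact: cvg_cst|exact: cf].
Qed.

Section MaximumPrinciple.
Context {R : realType} {d : nat}.
Local Notation M := 'M[R[i]]_d.
Variable mu : {measure set M -> \bar R}.

Lemma continuous_mulmxr (F : M -> R) (A : M) : continuous F ->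
  continuous (fun v : M => F (v *m A)).
Proof.
move=> cF v U hU; have /nbhs_onormP [k k0 hk] := cF (v *m A) U hU.
have [e e0 he] := mulmx_near v A k0.
apply/nbhs_onormP; exists e => // w hw; apply/hk/he => //.
by rewrite subrr onorm0.
Qed.

Lemma measurable_EFin_mulmxr (F : M -> R) (A : M) : continuous F ->
  measurable_fun setT (fun v : M => (F (v *m A))%:E).
Proof.
move=> cF; apply/measurable_EFinP; apply: continuous_measurable_mx.
exact: continuous_mulmxr.
Qed.

Lemma homog_normalize (A : M) : A != 0 -> exists2 B : M, onorm B = 1 &
  forall s (h : M -> R), homog s h -> h A = onorm A `^ s * h B.
Proof.
move=> A0; have nA : 0 < onorm A by rewrite onorm_gt0.
exists (((onorm A)^-1)%:C%C *: A).
  by rewrite onormZ normc_real ?invr_ge0 ?onorm_ge0 // mulVf // gt_eqF.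
move=> s h hh; rewrite -hh ?onorm_ge0 //.
by rewrite scalerA -rmorphM /= divff ?gt_eqF // scale1r.
Qed.

Variables (s K : R) (F G : M -> R).
Hypothesis s_gt0 : 0 < s.
Hypothesis K_gt0 : 0 < K.
Hypothesis mu_irr : mx_irreducible mu.
Hypothesis mu_contr : mx_contracting mu.
Hypothesis cF : continuous F.
Hypothesis cG : continuous G.
Hypothesis hF : homog s F.
Hypothesis hG : homog s G.
Hypothesis F_ge0 : forall A, 0 <= F A.
Hypothesis G_gt0 : forall A, A != 0 -> 0 < G A.
Hypothesis subharmonicF : forall A, ((K * F A)%:E <= \int[mu]_v (F (v *m A))%:E)%E.
Hypothesis superharmonicG : forall A, (\int[mu]_v (G (v *m A))%:E <= (K * G A)%:E)%E.
Hypothesis F_rank1 : forall A, (\rank A <= 1)%N -> F A = 0.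

Let F0 : F 0 = 0. Proof. by apply: (homog0 _ hF); rewrite gt_eqF. Qed.
Let G0 : G 0 = 0. Proof. by apply: (homog0 _ hG); rewrite gt_eqF. Qed.

Let G_ge0 A : 0 <= G A.
Proof. by have [->|/G_gt0/ltW //] := eqVneq A 0; rewrite G0. Qed.

Let extremal_ratio : exists (r : R) (A0 : M),
  [/\ 0 <= r, A0 != 0, F A0 = r * G A0 & forall A, F A <= r * G A] \/
  (forall A, F A = 0).
Proof.
pose S := [set A : M | onorm A = 1].
have nz (A : M) : onorm A = 1 -> A != 0.
  by move=> A1; rewrite -onorm_gt0 A1.
(* An empty sphere leaves no nonzero matrix, so [F] vanishes identically. *)
have [S0|S0] := pselect (S !=set0); last first.
  exists 0, 0; right => A; have [->//|A0] := eqVneq A 0.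
  have [B B1 _] := homog_normalize A0.
  by exfalso; apply: S0; exists B.
have cFG : {within S, continuous (fun A => F A / G A)}.
  apply: continuous_in_subspaceT => A /set_mem SA.
  have GA : G A != 0 by rewrite gt_eqF // G_gt0 // nz.
  exact: (continuousM (@cF A) (continuousV GA (@cG A))).
have [A0 /set_mem A0S A0max] := compact_EVT_max S0 (@compact_onorm_sphere R d) cFG.
have GA0 := G_gt0 (nz _ A0S).
exists (F A0 / G A0), A0; left; split => //.
- by rewrite divr_ge0 // ltW.
- exact: nz.
- by rewrite divfK // gt_eqF.
- move=> A; have [->|An0] := eqVneq A 0; first by rewrite F0 G0 mulr0.
  have [B B1 hB] := homog_normalize An0.
  rewrite (hB _ _ hF) (hB _ _ hG) mulrCA ler_wpM2l ?powR_ge0 //.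
  by rewrite -ler_pdivrMr ?G_gt0 ?nz //; apply: A0max; exact: mem_set.
Qed.

(** If [D], the difference [r * G - F], were positive at [v *m A], it would exceed a positive [t] on
    an open set of factors around [v], which has positive measure. Its integral would be positive,
    against the integrals of [F] and [D] adding up to at most [K * F A]. *)
Let extremal_msupp r A v : 0 <= r -> (forall A, F A <= r * G A) ->
  F A = r * G A -> msupp mu v -> F (v *m A) = r * G (v *m A).
Proof.
move=> r0 FrG FA hv; apply/eqP; rewrite eq_le FrG /= leNgt; apply/negP => lt.
pose D X := r * G X - F X.
have cD : continuous D.
  exact: continuous_mulB cG cF.
have D0 X : 0 <= D X by rewrite subr_ge0.
pose t := D (v *m A) / 2.
have Dv : 0 < D (v *m A) by rewrite subr_gt0.
have t0 : 0 < t by rewrite divr_gt0.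
pose U := [set w : M | t < D (w *m A)].
have oU : open U.
  have /continuousP := @continuous_mulmxr D A cD.
  by move/(_ [set x | t < x]); apply; exact: open_gt.
have Uv : U v by rewrite /U /= ltr_pdivrMr // mulr_natr mulr2n ltrDl.
have muU := hv U oU Uv.
have IDpos : (0 < \int[mu]_w (D (w *m A))%:E)%E.
  apply: (@lt_le_trans _ _ (t%:E * mu U)%E); first by rewrite mule_gt0.
  apply: integral_ge_on => //.
  - exact: open_measurable_mx.
  - exact: measurable_EFin_mulmxr.
  - by move=> w; rewrite lee_fin.
  - exact: ltW.
  - by move=> w /= /ltW; rewrite lee_fin.
have IF : (\int[mu]_w (F (w *m A))%:E + \int[mu]_w (D (w *m A))%:E <=
    (K * F A)%:E)%E.
  rewrite -ge0_integralD //=; last 4 first.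
  - by move=> w _; rewrite lee_fin.
  - exact: measurable_EFin_mulmxr.
  - by move=> w _; rewrite lee_fin.
  - exact: measurable_EFin_mulmxr.
  under eq_integral do rewrite -EFinD /D addrC subrK EFinM.
  rewrite ge0_integralZl_EFin //.
  - rewrite FA mulrCA EFinM lee_wpmul2l ?lee_fin //.
  - by move=> w _; rewrite lee_fin.
  - exact: measurable_EFin_mulmxr.
(* The integral of [F] is replaced by its lower bound [K * F A], a real number, which can be
   cancelled. *)
have := le_trans (leeD2r (\int[mu]_w (D (w *m A))%:E)%E (subharmonicF A)) IF.
by rewrite -[X in (_ <= X)%E]adde0 leeD2lE // leNgt IDpos.
Qed.

(* The set where F = r G is stable under the support of mu, hence it contains
   a nonzero matrix of rank one, where F vanishes. *)
Lemma max_principle A : F A = 0.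
Proof.
have [r [A0 [[r0 A0n0 FA0 FrG]|//]]] := extremal_ratio.
suff -> : F A = 0 by [].
suff r00 : r = 0.
  by apply/le_anti; rewrite F_ge0 andbT -[X in _ <= X](mul0r (G A)) -r00.
have EqT a : mx_semigroup mu a -> forall X, F X = r * G X -> F (a *m X) = r * G (a *m X).
  move: a; apply: mx_semigroup_ind => [X|a v _ IH hv X hX]; first by rewrite mul1mx.
  by rewrite -mulmxA; apply: IH; exact: extremal_msupp.
have [v [w [hv vw rw]]] := mu_contr.
have [q [a [b [aT ab]]]] := irreducible_resolution mu_irr A0n0.
(* The limit [w] could annihilate [A0], so the point is first moved by a word [a l]: were every
   [w *m (a l *m A0)] zero, the resolution of the identity would give [w = 0]. *)
have [l wl] : exists l, w *m (a l *m A0) != 0.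
  apply: contrapT => h; suff w0 : w = 0 by rewrite w0 mxrank0 in rw.
  rewrite -[w]mulmx1 -ab mulmx_sumr big1 // => l _.
  have : w *m (a l *m A0) = 0 by apply: contrapT => /eqP ?; apply: h; exists l.
  by rewrite -!mulmxA => /(congr1 (mulmx^~ (b l))); rewrite mul0mx -!mulmxA.
pose X := a l *m A0.
have FX : F X = r * G X by exact: EqT.
pose D Y := r * G (Y *m X) - F (Y *m X).
have cD : continuous D.
  have cF' := @continuous_mulmxr F X cF; have cG' := @continuous_mulmxr G X cG.
  exact: continuous_mulB cG' cF'.
have D0 k : D (real_complex R (opnorm (v k))^-1 *: v k) = 0.
  have [vT vn0] := hv k; have n0 : 0 <= (opnorm (v k))^-1.
    by have := onorm_ge0 (v k); rewrite onorm.unlock invr_ge0.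
  rewrite /D -scalemxAl hF // hG // mulrCA -mulrBr.
  by rewrite (EqT _ vT) // subrr mulr0.
have : D w = 0.
  have /(_ _) Dcvg := cvg_comp _ _ vw (cD w).
  have : D \o (fun k => real_complex R (opnorm (v k))^-1 *: v k) = cst 0.
    by apply/funext => k /=; exact: D0.
  move=> E; rewrite E in Dcvg.
  exact: cvg_unique Dcvg (cvg_cst 0).
(* At the nonzero matrix [w *m X] of rank at most one, [F] vanishes while [G] is positive; equality
   there forces [r = 0]. *)
have FwX : F (w *m X) = 0 by apply: F_rank1; rewrite -rw; exact: mxrankM_maxl.
rewrite /D FwX subr0 => /eqP; rewrite mulf_eq0 => /orP[/eqP //|].
by rewrite gt_eqF // G_gt0.
Qed.

End MaximumPrinciple.

(** * Growth of the moments *)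

Section LowerBound.
Context {R : realType} {d : nat}.
Local Notation M := 'M[R[i]]_d.
Variable mu : {sigma_finite_measure set M -> \bar R}.
Local Notation P := (transfer mu).

Definition efun (g : M -> R) (A : M) : \bar R := (g A)%:E.

Lemma measurable_efun (g : M -> R) : continuous g -> measurable_fun setT (efun g).
Proof. by move=> cg; apply/measurable_EFinP; exact: continuous_measurable_mx. Qed.

Lemma efun_ge0 (g : M -> R) : (forall A, 0 <= g A) -> forall A, (0 <= efun g A)%E.
Proof. by move=> g0 A; rewrite lee_fin. Qed.

(** [j] is the length of a word for [a]: each letter may vary in a neighbourhood of positive measure
    without the product leaving [U], and [c] is a product of lower bounds of these measures. Both
    depend on [a] and [U] only, which makes the estimate uniform in [g], [t] and [A]. *)
Lemma semigroup_lower a : mx_semigroup mu a -> forall U, nbhs a U ->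
  exists (j : nat) (c : R), 0 < c /\ forall (g : M -> \bar R) t A,
    (forall B, 0 <= g B)%E -> measurable_fun setT g -> 0 <= t ->
    (forall b, U b -> t%:E <= g (b *m A))%E -> ((c * t)%:E <= iter j P g A)%E.
Proof.
move: a; apply: mx_semigroup_ind => [U /nbhs_singleton U1|a v _ IH hv U].
  exists 0%N, 1; split => // g t A _ _ _ /(_ _ U1).
  by rewrite mul1mx mul1r.
move=> /nbhs_onormP [k k0 kU]; have [e e0 he] := mulmx_near a v k0.
have [] := IH [set b | onorm (b - a) < e]; first by apply/nbhs_onormP; exists e.
move=> j [c [c0 hc]].
pose V := [set w : M | onorm (w - v) < e].
have oV : open V.
  rewrite openE => w hw; apply/nbhs_onormP; exists (e - onorm (w - v)).
    by rewrite subr_gt0.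
  move=> u hu; have := onormD (u - w) (w - v); rewrite subrKA => /le_lt_trans.
  by apply; rewrite -ltrBrDr.
have Vv : V v by rewrite /V /= subrr onorm0.
have muV := hv V oV Vv.
(* The measure of [V] may be infinite; then [1] serves as the bound. *)
have [c' [c'0 c'V]] : exists c' : R, 0 < c' /\ (c'%:E <= mu V)%E.
  case: (mu V) muV => [r| |//]; first by rewrite lte_fin => r0; exists r.
  by exists 1; split => //; rewrite leey.
exists j.+1, (c * c'); split => [|g t A g0 mg t0 ht]; first exact: mulr_gt0.
have ct0 : 0 <= c * t by rewrite mulr_ge0 // ltW.
rewrite mulrAC EFinM; apply: (@le_trans _ _ ((c * t)%:E * mu V)%E).
  by rewrite lee_wpmul2l // lee_fin.
rewrite /=; apply: integral_ge_on => //.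
- exact: open_measurable_mx.
- by apply: measurable_comp_mulmxr; exact: measurable_iter_transfer.
- by move=> w; exact: iter_transfer_ge0.
move=> w Vw; apply: hc => // b hb; rewrite mulmxA; apply: ht.
by apply: kU; exact: he.
Qed.

(** Bounding the sum by [q] times its largest term works for every [r > 0], on both sides of the
    convexity threshold [1]. *)
Lemma powR_sum_le (r : R) (q : nat) (x : 'I_q -> R) : 0 < r -> (forall l, 0 <= x l) ->
  (\sum_l x l) `^ r <= q%:R `^ r * \sum_l x l `^ r.
Proof.
move=> r0 x0; case: q x x0 => [|q] x x0.
  by rewrite !big_ord0 powR0 ?gt_eqF // mulr0.
have [l _ lmax] := @arg_maxP _ R 'I_q.+1 ord0 xpredT x isT.
apply: (@le_trans _ _ ((q.+1%:R * x l) `^ r)).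
  apply: powR_le; first exact: ltW.
    by apply: sumr_ge0.
  apply: (@le_trans _ _ (\sum_(i < q.+1) x l)); first by apply: ler_sum => i _; exact: lmax.
  by rewrite sumr_const card_ord mulr_natl.
rewrite powRM // ler_wpM2l ?powR_ge0 // (bigD1 l) //= lerDl.
by apply: sumr_ge0 => i _; exact: powR_ge0.
Qed.

Lemma iter_transfer_homog n s (g : M -> R) c A : homog s g -> (forall B, 0 <= g B) ->
  continuous g -> 0 <= c ->
  iter n P (efun g) (c%:C%C *: A) = ((c `^ s)%:E * iter n P (efun g) A)%E.
Proof.
move=> hg g0 cg c0; rewrite -[in LHS](mul1mx (_ *: A)) -iter_transfer_mulmxr.
rewrite -[in RHS](mul1mx A) -iter_transfer_mulmxr.
rewrite -iter_transferZ ?powR_ge0 //.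
- congr (iter n P _ 1%:M); apply/funext => X.
  by rewrite /efun -scalemxAr hg // EFinM.
- by move=> B; rewrite lee_fin.
- by apply: measurable_comp_mulmxr; exact: measurable_efun.
Qed.

Variable s : R.
Hypothesis s_gt0 : 0 < s.
Local Notation N := (efun (onorm_pow s)).
Local Notation m p := (iter p P N 1%:M).

Lemma measurable_N : measurable_fun setT N.
Proof. by apply: measurable_efun; exact: onorm_pow_continuous. Qed.

Lemma N_ge0 A : (0 <= N A)%E.
Proof. by rewrite lee_fin onorm_pow_ge0. Qed.

(** Under small perturbations [D], the sum of the [a' l *m A' *m b l], stays within [1/2] of the
    identity, so [onorm v] is at most twice [onorm (v *m D)], hence at most [2 * B] times the sum of
    the [onorm (v *m (a' l *m A'))]. Raising to the power [s] and applying the transfer operator [p]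
    times gives a [C] independent of [p]. *)
Let lower_at (q : nat) (a b : 'I_q -> M) (A : M) :
  \sum_l a l *m A *m b l = 1%:M ->
  exists2 C : R, 0 < C & exists2 e : R, 0 < e & forall a' A',
    (forall l, onorm (a' l - a l) < e) -> onorm (A' - A) < e ->
    forall p, (m p <= C%:E * \sum_l iter p P N (a' l *m A'))%E.
Proof.
move=> ab.
pose B := \sum_l onorm (b l) + 1.
have B0 : 0 < B by rewrite ltr_pwDr // sumr_ge0 // => l _; exact: onorm_ge0.
have bB l : onorm (b l) <= B.
  rewrite /B (bigD1 l) //= -addrA lerDl addr_ge0 // sumr_ge0 // => i _.
  exact: onorm_ge0.
(* An error [k] in each term, multiplied by [onorm (b l)] and summed, gives at most [1/2]. *)
pose k := (2 * B)^-1; have k0 : 0 < k by rewrite invr_gt0 mulr_gt0.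
have : \forall e \near 0^'+, forall l (a' A' : M),
    onorm (a' - a l) < e -> onorm (A' - A) < e -> onorm (a' *m A' - a l *m A) < k.
  apply: filter_forall => l; have [e e0 he] := mulmx_near (a l) A k0.
  near=> h => a' A' h1 h2; apply: he.
    by apply: (lt_trans h1); near: h; exact: nbhs_right_lt.
  by apply: (lt_trans h2); near: h; exact: nbhs_right_lt.
move=> hnear.
have [e e0 he] : exists2 e : R, 0 < e & forall l (a' A' : M),
    onorm (a' - a l) < e -> onorm (A' - A) < e -> onorm (a' *m A' - a l *m A) < k.
  have : \forall e \near 0^'+, 0 < e /\ forall l (a' A' : M),
    onorm (a' - a l) < e -> onorm (A' - A) < e -> onorm (a' *m A' - a l *m A) < k.
    by apply: filterS2 (nbhs_right_gt 0) hnear => e e0 he; split.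
  by move=> /filter_ex [e [e0 he]]; exists e.
(* The added [1] keeps [C] positive even for [q = 0]. *)
pose C := (2 * B) `^ s * (q%:R `^ s + 1).
have C0 : 0 < C.
  by rewrite mulr_gt0 ?powR_gt0 ?mulr_gt0 // ltr_wpDl ?powR_ge0.
exists C => //; exists e => // a' A' ha hA p.
pose D := \sum_l a' l *m A' *m b l.
have D1 : onorm (1%:M - D) <= 2^-1.
  rewrite /D -ab -sumrB; apply: le_trans (onorm_sum _) _.
  apply: (@le_trans _ _ (\sum_l k * onorm (b l))).
    apply: ler_sum => l _; rewrite -mulmxBl; apply: le_trans (onormM _ _) _.
    rewrite ler_wpM2r ?onorm_ge0 // onormB; apply: ltW; exact: he.
  rewrite -mulr_sumr /k invfM -mulrA ler_piMr ?invr_ge0 //.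
  by rewrite mulrC ler_pdivrMr // mul1r lerDl.
have vD v : onorm v <= 2 * onorm (v *m D).
  have : onorm v <= onorm v * 2^-1 + onorm (v *m D).
    have {1}-> : v = v *m (1%:M - D) + v *m D by rewrite mulmxBr mulmx1 subrK.
    apply: le_trans (onormD _ _) _; rewrite lerD2r.
    by apply: le_trans (onormM _ _) _; rewrite ler_wpM2l ?onorm_ge0.
  by move: (onorm v) (onorm _) => x y; lra.
have vN v : onorm_pow s v <= C * \sum_l onorm_pow s (v *m (a' l *m A')).
  have h1 : onorm v <= 2 * B * \sum_l onorm (v *m (a' l *m A')).
    apply: le_trans (vD v) _; rewrite -mulrA ler_pM2l // /D mulmx_sumr.
    apply: le_trans (onorm_sum _) _; rewrite mulr_sumr; apply: ler_sum => l _.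
    rewrite -mulmxA !mulmxA; apply: le_trans (onormM _ _) _.
    by rewrite mulrC ler_wpM2r ?onorm_ge0.
  have S0 : 0 <= \sum_l onorm (v *m (a' l *m A')).
    by apply: sumr_ge0 => l _; exact: onorm_ge0.
  apply: le_trans (powR_le (ltW s_gt0) (onorm_ge0 _) h1) _.
  rewrite powRM //; last by rewrite mulr_ge0 // ltW.
  rewrite /C -mulrA ler_wpM2l ?powR_ge0 //.
  apply: le_trans (powR_sum_le s_gt0 (fun l => onorm_ge0 (v *m (a' l *m A')))) _.
  rewrite ler_wpM2r ?lerDl // sumr_ge0 // => l _; exact: powR_ge0.
have -> : (C%:E * \sum_l iter p P N (a' l *m A') =
   iter p P (fun X => C%:E * \sum_l N (X *m (a' l *m A'))) 1%:M)%E.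
  rewrite (iter_transferZ _ _ (ltW C0)).
  - rewrite iter_transfer_sum //.
    + congr (_ * _)%E; apply: eq_bigr => l _.
      by rewrite iter_transfer_mulmxr mul1mx.
    + by move=> l X; exact: N_ge0.
    + by move=> l; apply: measurable_comp_mulmxr; exact: measurable_N.
  - by move=> X; apply: sume_ge0 => l _; exact: N_ge0.
  - apply: emeasurable_sum => l; apply: measurable_comp_mulmxr; exact: measurable_N.
apply: iter_transfer_le.
- exact: N_ge0.
- exact: measurable_N.
- apply: measurable_funeM; apply: emeasurable_sum => l; apply: measurable_comp_mulmxr.
  exact: measurable_N.
- by move=> v; rewrite sumEFin -EFinM lee_fin.
Unshelve. all: by end_near. Qed.

Hypothesis mu_irr : mx_irreducible mu.
Hypothesis m_fin : forall p, (m p < +oo)%E.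

(** [n] plays two roles, exceeding all word lengths [(jc l).1] and making [n.+1%:R^-1] a small
    enough constant. Both hold eventually, so compactness of the sphere can later provide a single
    [n]. The index [l] that realizes the bound may depend on [p] and [A']; [n] does not. *)
Let lower_near (A : M) : A != 0 -> \forall A' \near A & n \near \oo,
  forall p, ((n.+1%:R^-1)%:E * m p <= \sum_(j < n) iter j P (iter p P N) A')%E.
Proof.
move=> A0; have [q [a [b [aT ab]]]] := irreducible_resolution mu_irr A0.
have [C C0 [e e0 hC]] := lower_at ab.
have /choice [jc hjc] : forall l, exists jc : nat * R, 0 < jc.2 /\
    forall (g : M -> \bar R) (t : R) (A : M), (forall B, 0 <= g B)%E -> measurable_fun setT g ->
      0 <= t -> (forall b : M, (onorm (b - a l) < e)%R -> t%:E <= g (b *m A))%E ->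
      ((jc.2 * t)%:E <= iter jc.1 P g A)%E.
  move=> l; have nU : nbhs (a l) [set b | onorm (b - a l) < e].
    by apply/nbhs_onormP; exists e.
  by have [j [c [c0 hc]]] := semigroup_lower (aT l) nU; exists (j, c).
(* If near every [a l] some [b'] had [iter p P N (b' *m A')] at most [m p / D], then [lower_at]
   would bound [m p] by [q / (2 * q.+1)] times itself. So for some [l] the bound [m p / D] holds on
   the whole neighbourhood, as [semigroup_lower] requires. *)
pose D := 2 * C * q.+1%:R; have D0 : 0 < D by rewrite !mulr_gt0.
have hn : \forall n \near \oo, forall l,
    ((jc l).1 < n)%N /\ n.+1%:R^-1 <= (jc l).2 / D.
  apply: filter_forall => l; near=> n; split; first by near: n; exact: nbhs_infty_gt.
  have cD : 0 < (jc l).2 / D by rewrite divr_gt0 //; case: (hjc l).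
  rewrite invf_ple ?posrE //; apply: ltW; near: n.
  exists (Num.truncn ((jc l).2 / D)^-1) => // n /= hn.
  by apply: lt_le_trans (truncnS_gt _) _; rewrite ler_nat ltnS.
exists ([set A' | onorm (A' - A) < e],
    [set n | forall l, ((jc l).1 < n)%N /\ n.+1%:R^-1 <= (jc l).2 / D]).
  by split=> //; apply/nbhs_onormP; exists e.
move=> [A' n] /= [hA' {}hn] p.
have g0 X : (0 <= iter p P N X)%E by apply: iter_transfer_ge0; exact: N_ge0.
have mE : m p = (fine (m p))%:E by rewrite fineK // ge0_fin_numE // m_fin.
have [m0|m0] := eqVneq (fine (m p)) 0.
  rewrite mE m0 mule0; apply: sume_ge0 => j _; exact: iter_transfer_ge0.
have mgt : 0 < fine (m p) by rewrite lt_neqAle eq_sym m0 fine_ge0.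
pose t := fine (m p) / D.
have t0 : 0 <= t by rewrite divr_ge0 // ltW.
have [l hl] : exists l, forall b' : M, onorm (b' - a l) < e ->
    (t%:E <= iter p P N (b' *m A'))%E.
  apply: contrapT => h.
  have /choice [a' ha'] : forall l, exists b' : M, onorm (b' - a l) < e /\
      (iter p P N (b' *m A') <= t%:E)%E.
    move=> l; apply: contrapT => h'; apply: h; exists l => b' hb'.
    by rewrite leNgt; apply/negP => lt; apply: h'; exists b'; split => //; exact: ltW.
  have := hC a' A' (fun l => (ha' l).1) hA' p; apply/negP; rewrite -ltNge.
  apply: (@le_lt_trans _ _ (C%:E * \sum_(l < q) t%:E)%E).
    apply: lee_wpmul2l; first by rewrite lee_fin ltW.
    by apply: lee_sum => l _; have [_] := ha' l.
  rewrite sumEFin -EFinM [X in (_ < X)%E]mE lte_fin sumr_const card_ord /t /D.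
  move: (fine _) mgt => y y0; rewrite -[X in C * X]mulr_natr.
  have -> : C * (y / (2 * C * q.+1%:R) * q%:R) = y * (q%:R / (2 * q.+1%:R)).
    have : q.+1%:R != 0 :> R by rewrite pnatr_eq0.
    by move: (q.+1%:R) => k k0; field; rewrite k0 gt_eqF.
  rewrite gtr_pMr // ltr_pdivrMr ?mulr_gt0 // mul1r -natrM ltr_nat mul2n -addnn.
  by rewrite addSn ltnS leq_addr.
have [c0 hc] := hjc l; have [jn cn] := hn l.
apply: (@le_trans _ _ (iter (jc l).1 P (iter p P N) A')).
  apply: (le_trans _ (hc _ _ _ g0 _ t0 hl)); last first.
    by apply: measurable_iter_transfer; [exact: N_ge0|exact: measurable_N].
  rewrite mE -EFinM lee_fin /t mulrA mulrAC ler_wpM2r //; exact: ltW.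
rewrite (bigD1 (Ordinal jn)) //= leeDl // sume_ge0 // => j _.
exact: iter_transfer_ge0.
Unshelve. all: by end_near. Qed.

(** Compactness of the unit sphere makes the local bounds uniform, and homogeneity carries them to
    all [A]. *)
Lemma transfer_lower : exists (J : nat) (c : R), 0 < c /\ forall p (A : M),
  ((c * onorm_pow s A)%:E * m p <= \sum_(j < J) iter j P (iter p P N) A)%E.
Proof.
have /compact_near_coveringP cK := @compact_onorm_sphere R d.
have : \forall n \near \oo, [set A : M | onorm A = 1] `<=` (fun A => forall p,
    ((n.+1%:R^-1)%:E * m p <= \sum_(j < n) iter j P (iter p P N) A)%E).
  apply: (cK _ \oo (fun n A => forall p,
    ((n.+1%:R^-1)%:E * m p <= \sum_(j < n) iter j P (iter p P N) A)%E)).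
  by move=> A /= A1; apply: lower_near; rewrite -onorm_gt0 A1.
move=> [n _ /(_ n (leqnn n)) hn]; exists n, n.+1%:R^-1; split=> [|p A].
  by rewrite invr_gt0.
have g0 X : (0 <= iter p P N X)%E by apply: iter_transfer_ge0; exact: N_ge0.
have [->|A0] := eqVneq A 0.
  rewrite /onorm_pow onorm0 powR0 ?gt_eqF // mulr0 mul0e.
  by apply: sume_ge0 => j _; exact: iter_transfer_ge0.
have nA : 0 < onorm A by rewrite onorm_gt0.
pose B := ((onorm A)^-1)%:C%C *: A.
have AE : A = (onorm A)%:C%C *: B.
  by rewrite scalerA -rmorphM /= divff ?gt_eqF // scale1r.
have B1 : onorm B = 1.
  by rewrite onormZ normc_real ?invr_ge0 ?onorm_ge0 // mulVf // gt_eqF.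
have -> : (\sum_(j < n) iter j P (iter p P N) A =
    (onorm_pow s A)%:E * \sum_(j < n) iter j P (iter p P N) B)%E.
  rewrite ge0_sume_distrr; last by move=> j _; exact: iter_transfer_ge0.
  apply: eq_bigr => j _; rewrite -!iterD [in LHS]AE.
  rewrite (iter_transfer_homog _ _ (@homog_onorm_pow R d s)) ?onorm_ge0 //.
    exact: onorm_pow_ge0.
  exact: onorm_pow_continuous.
rewrite mulrC EFinM -muleA lee_wpmul2l ?lee_fin ?onorm_pow_ge0 //.
exact: hn.
Qed.

End LowerBound.

(** * Growth rate of a quasi-multiplicative sequence *)

Section QuasiMultiplicative.
Variables (R : realType) (a : nat -> R) (c : R).
Hypothesis c_gt0 : 0 < c.
Hypothesis a_gt0 : forall n, 0 < a n.
Hypothesis a0 : a 0%N = 1.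
Hypothesis a_sub : forall n p, a (n + p)%N <= a n * a p.
Hypothesis a_super : forall n p, c * (a n * a p) <= a (n + p)%N.

Let a_exp_sub n p : a (n * p)%N <= a p ^+ n.
Proof.
elim: n => [|n IH]; first by rewrite mul0n a0 expr0.
rewrite mulSn exprS; apply: le_trans (a_sub _ _) _.
by rewrite ler_wpM2l // ltW.
Qed.

Let a_exp_super n p : (c * a n) ^+ p <= a (p * n)%N.
Proof.
elim: p => [|p IH]; first by rewrite mul0n a0 expr0.
rewrite mulSn exprS; apply: le_trans (a_super _ _).
by rewrite -mulrA ler_wpM2l ?(ltW c_gt0) // ler_wpM2l // ltW.
Qed.

Let root (x : R) n := x `^ n%:R^-1.

Let rootX x n : 0 <= x -> (0 < n)%N -> root x n ^+ n = x.
Proof.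
move=> x0 n0; rewrite -powR_mulrn ?powR_ge0 // -powRrM mulVf ?powRr1 //.
by rewrite pnatr_eq0 -lt0n.
Qed.

Let root_le x y n p : 0 <= x -> 0 <= y -> (0 < n)%N -> (0 < p)%N ->
  x ^+ p <= y ^+ n -> root x n <= root y p.
Proof.
move=> x0 y0 n0 p0 xy.
rewrite -(ler_pXn2r (n := n * p)) ?muln_gt0 ?n0 // ?nnegrE ?powR_ge0 //.
by rewrite exprM rootX // mulnC exprM rootX.
Qed.

(** A two-sided Fekete lemma. From [(c * a n) ^+ p <= a (p * n) <= a p ^+ n], every root of
    [c * a n] lies below every root of [a p]; [K] is the supremum of the former. Hence
    [c * a n <= K ^+ n <= a n] at every [n], and the limit follows because the [n]-th root of [c]
    tends to [1]. *)
Lemma quasi_multiplicative_growth : exists K : R,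
  [/\ 0 < K, forall n, K ^+ n <= a n, forall n, c * a n <= K ^+ n &
      (fun n => a n `^ n%:R^-1) @ \oo --> K].
Proof.
pose A := [set root (c * a n) n | n in [set n | (0 < n)%N]].
have ca n : 0 <= c * a n by rewrite ltW // mulr_gt0.
have hA p : (0 < p)%N -> ubound A (root (a p) p).
  move=> p0 _ [n n0 <-]; apply: root_le => //; first exact: ltW.
  by apply: le_trans (a_exp_super _ _) _; rewrite mulnC.
pose K := sup A.
have supA : has_sup A.
  by split; [exists (root (c * a 1%N) 1), 1%N|exists (root (a 1%N) 1); exact: hA].
have Kge n : (0 < n)%N -> root (c * a n) n <= K.
  by move=> n0; apply: sup_upper_bound => //; exists n.
have Kle n : (0 < n)%N -> K <= root (a n) n.
  by move=> n0; apply: ge_sup; [case: supA|exact: hA].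
have K0 : 0 < K.
  by apply: lt_le_trans (Kge 1%N isT); rewrite powR_gt0 // mulr_gt0.
have Kn n : K ^+ n <= a n.
  case: n => [|n]; first by rewrite expr0 a0.
  rewrite -(rootX (ltW (a_gt0 n.+1)) (ltn0Sn n)).
  by rewrite (ler_pXn2r (n := n.+1)) // ?nnegrE ?powR_ge0 ?(ltW K0) // Kle.
have c1 : c <= 1 by have := a_super 0%N 0%N; rewrite addn0 a0 !mulr1.
have cKn n : c * a n <= K ^+ n.
  case: n => [|n]; first by rewrite expr0 a0 mulr1.
  rewrite -(rootX (ca n.+1) (ltn0Sn n)).
  by rewrite (ler_pXn2r (n := n.+1)) // ?nnegrE ?powR_ge0 ?(ltW K0) // Kge.
exists K; split => //.
have cV : (fun n => c `^ (- n%:R^-1)) @ \oo --> (1 : R).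
  rewrite -[X in _ --> X]expR0.
  have -> : (fun n => c `^ (- n%:R^-1)) = (fun n => expR (- n%:R^-1 * ln c)).
    by apply/funext => n; rewrite /powR gt_eqF.
  have c0 : (fun n => - n%:R^-1 * ln c) @ \oo --> (0 : R).
    rewrite -[X in _ --> X](mul0r (ln c)); apply: cvgMr_tmp.
    by rewrite -[X in _ --> X]oppr0; apply: cvgN; rewrite -cvg_shiftS; exact: cvg_harmonic.
  exact: continuous_cvg (@continuous_expR R 0) c0.
apply: (@squeeze_cvgr _ _ _ _ (cst K) (fun n => c `^ (- n%:R^-1) * K)).
- near=> n; have n0 : (0 < n)%N by near: n; exact: nbhs_infty_gt.
  rewrite Kle //= powRN ler_pdivlMl ?powR_gt0 //.
  by have := Kge n n0; rewrite /root powRM // ltW.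
- exact: cvg_cst.
- by rewrite -[X in _ --> X](mul1r K); apply: cvgMr_tmp.
Unshelve. all: by end_near. Qed.

End QuasiMultiplicative.

(** * Limits of normalized iterates *)

Section Limsup.
Context {R : realType} {d : nat}.
Local Notation M := 'M[R[i]]_d.
Variable mu : {measure set M -> \bar R}.
Variables (s K C : R) (f : nat -> M -> R).
Hypothesis s_gt0 : 0 < s.
Hypothesis K_gt0 : 0 < K.
Hypothesis C_ge0 : 0 <= C.
Hypothesis f_bound : forall n A, `|f n A| <= C * onorm_pow s A.
Hypothesis f_equicontinuous : forall (A : M) e, 0 < e ->
  exists2 k : R, 0 < k & forall B, onorm (B - A) < k -> forall n, `|f n B - f n A| <= e.
Hypothesis f_homog : forall n, homog s (f n).
Hypothesis f_transfer : forall n A, (\int[mu]_v (f n (v *m A))%:E = (K * f n.+1 A)%:E)%E.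
Hypothesis mu_moment : (\int[mu]_v (onorm_pow s v)%:E < +oo)%E.

Let tail N A : set R := [set f n A | n in [set n | (N <= n)%N]].
Let S N A : R := sup (tail N A).
Let F A : R := inf (range (S^~ A)).

Let tail_has_sup N A : has_sup (tail N A).
Proof.
split; first by exists (f N A), N => /=.
by exists (C * onorm_pow s A) => _ [n _ <-]; exact: le_trans (ler_norm _) (f_bound n A).
Qed.

Let S_ub N n A : (N <= n)%N -> f n A <= S N A.
Proof. by move=> Nn; apply: sup_upper_bound => //; exists n. Qed.

Let S_le N A c : (forall n, (N <= n)%N -> f n A <= c) -> S N A <= c.
Proof.
by move=> h; apply: ge_sup; [case: (tail_has_sup N A)|move=> _ [n Nn <-]; exact: h].
Qed.

Let S_bound N A : `|S N A| <= C * onorm_pow s A.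
Proof.
rewrite ler_norml; apply/andP; split.
  apply: le_trans (S_ub A (leqnn N)).
  by have := f_bound N A; rewrite ler_norml => /andP[].
by apply: S_le => n _; exact: le_trans (ler_norm _) (f_bound n A).
Qed.

Let S_noninc A : {homo S^~ A : m n / (m <= n)%N >-> n <= m}.
Proof. by move=> m n mn; apply: S_le => k nk; apply: S_ub; exact: leq_trans nk. Qed.

Let S_has_inf A : has_inf (range (S^~ A)).
Proof.
split; first by exists (S 0 A), 0%N.
exists (- (C * onorm_pow s A)) => _ [n _ <-].
by have := S_bound n A; rewrite ler_norml => /andP[].
Qed.

Let F_le_S N A : F A <= S N A.
Proof. by apply: ge_inf; [case: (S_has_inf A)|exists N]. Qed.

Let F_ge A c : (forall N, c <= S N A) -> c <= F A.
Proof.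
by move=> h; apply: lb_le_inf; [case: (S_has_inf A)|move=> _ [N _ <-]; exact: h].
Qed.

Let cvg_S A : (S^~ A) @ \oo --> F A.
Proof. by apply: nonincreasing_cvgn; [exact: S_noninc|case: (S_has_inf A)]. Qed.

Let S_leD A B e : (forall n, f n B <= f n A + e) -> forall N, S N B <= S N A + e.
Proof.
move=> h N; apply: S_le => n Nn; apply: le_trans (h n) _.
by rewrite lerD2r; exact: S_ub.
Qed.

Let F_leD A B e : (forall n, f n B <= f n A + e) -> F B <= F A + e.
Proof.
move=> h; rewrite -lerBlDr; apply: F_ge => N; rewrite lerBlDr.
by apply: le_trans (F_le_S N B) _; exact: S_leD.
Qed.

Let S_continuous N : continuous (S N).
Proof.
move=> A; apply: continuous_onormP => e e0; have e2 : 0 < e / 2 by rewrite divr_gt0.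
have [k k0 hk] := f_equicontinuous A e2; exists k => // B hB.
have e2e : e / 2 < e by rewrite ltr_pdivrMr // mulr_natr mulr2n ltrDl.
apply: le_lt_trans e2e; rewrite ler_distl lerBlDr; apply/andP; split.
  by apply: S_leD => n; have := hk B hB n; rewrite distrC ler_distl => /andP[].
by apply: S_leD => n; have := hk B hB n; rewrite ler_distl => /andP[].
Qed.

Let F_continuous : continuous F.
Proof.
move=> A; apply: continuous_onormP => e e0; have e2 : 0 < e / 2 by rewrite divr_gt0.
have [k k0 hk] := f_equicontinuous A e2; exists k => // B hB.
have e2e : e / 2 < e by rewrite ltr_pdivrMr // mulr_natr mulr2n ltrDl.
apply: le_lt_trans e2e; rewrite ler_distl lerBlDr; apply/andP; split.
  by apply: F_leD => n; have := hk B hB n; rewrite distrC ler_distl => /andP[].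
by apply: F_leD => n; have := hk B hB n; rewrite ler_distl => /andP[].
Qed.

Let F_scale (c : R) A : 0 < c -> F (c%:C%C *: A) <= c `^ s * F A.
Proof.
move=> c0; rewrite -ler_pdivrMl ?powR_gt0 //; apply: F_ge => N.
rewrite ler_pdivrMl ?powR_gt0 //; apply: le_trans (F_le_S N _) _.
apply: S_le => n Nn; rewrite (f_homog _ _ (ltW c0)) ler_wpM2l ?powR_ge0 //.
exact: S_ub.
Qed.

Let F_homog : homog s F.
Proof.
move=> c A; rewrite le_eqVlt => /predU1P[<-|c0].
  rewrite scale0r powR0 ?gt_eqF // mul0r.
  have f0 n : f n 0 = 0 by apply: (homog0 _ (@f_homog n)); rewrite gt_eqF.
  apply/le_anti/andP; split.
    by apply: le_trans (F_le_S 0 _) _; apply: S_le => n _; rewrite f0.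
  by apply: F_ge => N; rewrite -(f0 N); exact: S_ub.
apply/le_anti; rewrite F_scale //=.
(* Applying [F_scale] with the inverse scalar gives the reverse inequality. *)
have cV : 0 < c^-1 by rewrite invr_gt0.
have := F_scale (c%:C%C *: A) cV.
rewrite scalerA -rmorphM /= mulVf ?gt_eqF // scale1r.
by rewrite -ler_pdivrMl ?powR_gt0 // -powRN -(powR_inv1 (ltW c0)) -powRrM mulN1r opprK.
Qed.

Let dom (A v : M) := ((C * onorm_pow s A) * onorm_pow s v)%:E : \bar R.

Let dom_bound A v x : `|x| <= C * onorm_pow s (v *m A) -> (`|x%:E| <= dom A v)%E.
Proof.
move=> h; rewrite lee_fin; apply: le_trans h _; rewrite -mulrA ler_wpM2l // mulrC.
by apply: onorm_powM; exact: ltW.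
Qed.

Let integrable_dom A : mu.-integrable setT (dom A).
Proof.
have mN : measurable_fun setT (fun v : M => (onorm_pow s v)%:E).
  by apply/measurable_EFinP; apply: continuous_measurable_mx; exact: onorm_pow_continuous.
apply/integrableP; split.
  by rewrite /dom; under eq_fun do rewrite EFinM; exact: measurable_funeM.
have CA0 : 0 <= C * onorm_pow s A by rewrite mulr_ge0 ?onorm_pow_ge0.
under eq_integral do rewrite /dom gee0_abs ?lee_fin ?mulr_ge0 ?onorm_pow_ge0 // EFinM.
rewrite ge0_integralZl_EFin //; first by rewrite lte_mul_pinfty.
by move=> v _; rewrite lee_fin onorm_pow_ge0.
Qed.

Let integrable_bounded (g : M -> R) A : continuous g ->
  (forall B, `|g B| <= C * onorm_pow s B) ->
  mu.-integrable setT (fun v => (g (v *m A))%:E).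
Proof.
move=> cg gb; apply: le_integrable (integrable_dom A) => //.
  exact: measurable_EFin_mulmxr.
move=> v _; apply: le_trans (dom_bound (gb _)) _.
by rewrite lee_fin ler_norm.
Qed.

Let f_continuous n : continuous (f n).
Proof.
move=> A; apply: continuous_onormP => e e0; have e2 : 0 < e / 2 by rewrite divr_gt0.
have [k k0 hk] := f_equicontinuous A e2; exists k => // B hB.
apply: le_lt_trans (hk B hB n) _.
by rewrite ltr_pdivrMr // mulr_natr mulr2n ltrDl.
Qed.

(** For [N <= n], [K * f n.+1 A] is the integral of [f n], at most that of [S N]. The supremum over
    [n] runs over the tail from [N.+1], which still dominates [F A]. *)
Let S_subharmonic N A : ((K * F A)%:E <= \int[mu]_v (S N (v *m A))%:E)%E.
Proof.
have iS := integrable_bounded A (@S_continuous N) (S_bound N).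
have fin : (\int[mu]_v (S N (v *m A))%:E \is a fin_num)%E.
  exact: integrable_fin_num.
rewrite -(fineK fin) lee_fin -ler_pdivlMl //.
apply: le_trans (F_le_S N.+1 A) _; apply: S_le => -[//|n] Nn.
rewrite ler_pdivlMl // -lee_fin (fineK fin) -f_transfer.
apply: le_integral => //.
  exact: integrable_bounded (@f_continuous n) (f_bound n).
by move=> v _; rewrite lee_fin; exact: S_ub.
Qed.

(** [S N] decreases to [F] under the integrable bound [dom A], so the inequality passes to the limit
    by dominated convergence. *)
Let F_subharmonic A : ((K * F A)%:E <= \int[mu]_v (F (v *m A))%:E)%E.
Proof.
have cS v : (fun N => (S N (v *m A))%:E) @ \oo --> (F (v *m A))%:E.
  by apply: cvg_EFin; [exact: nearW|exact: cvg_S].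
have [_ _ cvgI] := @dominated_convergence _ _ R mu setT measurableT
  (fun N v => (S N (v *m A))%:E) (fun v => (F (v *m A))%:E) (dom A)
  (fun N => measurable_EFin_mulmxr A (@S_continuous N))
  (measurable_EFin_mulmxr A F_continuous)
  (aeW mu (fun v _ => cS v))
  (integrable_dom A) (aeW mu (fun v N _ => dom_bound (S_bound N _))).
by apply: (cvge_to_ge cvgI); apply: nearW => N; exact: S_subharmonic.
Qed.

(** The functions [f n] may be negative, so that the liminf of a sequence is obtained by applying
    this to its opposite. *)
Lemma limsup_subharmonic : exists F : M -> R,
  [/\ continuous F, homog s F,
      forall A, ((K * F A)%:E <= \int[mu]_v (F (v *m A))%:E)%E,
      forall A c, (forall n, f n A <= c) -> F A <= c &
      forall A e, 0 < e -> \forall n \near \oo, f n A < F A + e].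
Proof.
exists F; split.
- exact: F_continuous.
- exact: F_homog.
- exact: F_subharmonic.
- by move=> A c h; apply: le_trans (F_le_S 0 A) _; exact: S_le.
- move=> A e e0; have /cvgrPdist_lt/(_ e e0) [N _ /(_ N (leqnn N)) /= hN] := @cvg_S A.
  exists N => // n /= Nn; apply: le_lt_trans (S_ub A Nn) _.
  by move: hN; rewrite distrC ltr_distl => /andP[].
Qed.

End Limsup.

Section Decay.
Context {R : realType} {d : nat}.
Local Notation M := 'M[R[i]]_d.
Variable mu : {sigma_finite_measure set M -> \bar R}.
Local Notation P := (transfer mu).
Variable s : R.
Hypothesis d_gt0 : (0 < d)%N.
Hypothesis s_gt0 : 0 < s.
Hypothesis mu_irr : mx_irreducible mu.
Hypothesis mu_moment : (\int[mu]_v (onorm_pow s v)%:E < +oo)%E.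
Local Notation N := (efun (@onorm_pow R d s)).
Local Notation m p := (iter p P N 1%:M).

Let mN : measurable_fun setT N := @measurable_N R d s s_gt0.
Let N0 : forall A, (0 <= N A)%E := @N_ge0 R d s.

Lemma onorm_pow1 : onorm_pow s (1%:M : M) = 1.
Proof. by rewrite /onorm_pow onorm1 // powR1. Qed.

Lemma iter_transfer_shift n (f : M -> \bar R) A :
  iter n P f A = iter n P (fun X => f (X *m A)) 1%:M.
Proof. by rewrite iter_transfer_mulmxr mul1mx. Qed.

Lemma iter_transfer_N_le n A : (iter n P N A <= N A * m n)%E.
Proof.
rewrite iter_transfer_shift -iter_transferZ ?onorm_pow_ge0 //.
apply: iter_transfer_le => //.
- exact: measurable_comp_mulmxr.
- exact: measurable_funeM.
- move=> X; rewrite -EFinM lee_fin mulrC; apply: onorm_powM; exact: ltW.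
Qed.

Lemma m_fin p : m p \is a fin_num.
Proof.
elim: p => [|p IH]; first by [].
rewrite ge0_fin_numE; last exact: iter_transfer_ge0.
apply: (@le_lt_trans _ _ (\int[mu]_v ((fine (m p))%:E * N v))%E).
  rewrite /= /transfer; apply: ge0_le_integral => //.
  - by move=> v _; exact: iter_transfer_ge0.
  - by apply: measurable_comp_mulmxr; exact: measurable_iter_transfer.
  - exact: measurable_funeM.
  - by move=> v _; rewrite mulmx1 fineK // muleC; exact: iter_transfer_N_le.
rewrite ge0_integralZl_EFin ?fine_ge0 ?iter_transfer_ge0 //.
by rewrite lte_mul_pinfty ?lee_fin ?fine_ge0 ?iter_transfer_ge0.
Qed.

Let am p := fine (m p).
Let amE p : m p = (am p)%:E. Proof. by rewrite fineK // m_fin. Qed.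
Let am_ge0 p : 0 <= am p. Proof. by rewrite fine_ge0 ?iter_transfer_ge0. Qed.

Let am0 : am 0%N = 1.
Proof. by rewrite /am /= /efun /= onorm_pow1. Qed.

Lemma moment_submul n p : am (n + p)%N <= am n * am p.
Proof.
rewrite -lee_fin EFinM -!amE iterD muleC.
have -> : (m p * m n = iter n P (fun X => (am p)%:E * N X) 1%:M)%E.
  by rewrite iter_transferZ // amE.
apply: iter_transfer_le.
- exact: iter_transfer_ge0.
- exact: measurable_iter_transfer.
- exact: measurable_funeM.
- by move=> X; rewrite -amE muleC; exact: iter_transfer_N_le.
Qed.

Let m_lty p : (m p < +oo)%E. Proof. by rewrite ltey_eq m_fin. Qed.

(** Applying the transfer operator [q] more times to the bound of [transfer_lower] gives
    [c * (am q * am p)] at most the sum over [j] of the moments of order [q + j + p];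
    submultiplicativity splits off the factors [am j]. *)
Let am_super : exists (J : nat) (c : R), [/\ 0 < c,
  forall p (A : M), ((c * onorm_pow s A * am p)%:E <= \sum_(j < J) iter j P (iter p P N) A)%E &
  forall q p, c * (am q * am p) <= am (q + p)%N * \sum_(j < J) am j].
Proof.
have [J [c [c0 hc]]] := transfer_lower s_gt0 mu_irr m_lty.
have hc' p A : ((c * onorm_pow s A * am p)%:E <= \sum_(j < J) iter j P (iter p P N) A)%E.
  by rewrite EFinM -amE; exact: hc.
exists J, c; split=> // q p.
have i0 j X : (0 <= iter j P (iter p P N) X)%E by do 2 apply: iter_transfer_ge0 => ?.
have mi j : measurable_fun setT (iter j P (iter p P N)).
  by apply: measurable_iter_transfer; [exact: iter_transfer_ge0|exact: measurable_iter_transfer].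
have cp0 : 0 <= c * am p by rewrite mulr_ge0 // ltW.
rewrite -lee_fin; apply: (@le_trans _ _ (\sum_(j < J) (am (q + p)%N * am j)%:E)%E); last first.
  by rewrite sumEFin mulr_sumr.
apply: (@le_trans _ _ (\sum_(j < J) iter q P (iter j P (iter p P N)) 1%:M)%E); last first.
  apply: lee_sum => j _; rewrite -!iterD amE lee_fin addnAC; exact: moment_submul.
rewrite -iter_transfer_sum //.
have -> : ((c * (am q * am p))%:E = iter q P (fun X => (c * am p)%:E * N X) 1%:M)%E.
  by rewrite iter_transferZ // amE -EFinM mulrA mulrAC.
apply: iter_transfer_le.
- by move=> X; rewrite mule_ge0 // lee_fin.
- exact: measurable_funeM.
- exact: emeasurable_sum.
- by move=> X; rewrite -EFinM mulrAC; exact: hc'.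
Qed.

Hypothesis m1_gt0 : 0 < fine (m 1).

Lemma moment_growth : exists (J : nat) (c b K : R), [/\ 0 < c, 0 < b, 0 < K,
  forall p (A : M), ((c * onorm_pow s A * am p)%:E <= \sum_(j < J) iter j P (iter p P N) A)%E &
  [/\ forall n, K ^+ n <= am n, forall n, b * am n <= K ^+ n &
  (fun n => am n `^ n%:R^-1) @ \oo --> K]].
Proof.
have [J [c [c0 hc am_sup]]] := am_super.
pose S := \sum_(j < J) am j.
have S0 : 0 <= S by apply: sumr_ge0.
have Sgt : 0 < S.
  have := am_sup 0%N 0%N; rewrite addn0 am0 !mulr1 mul1r -/S; exact: lt_le_trans.
(* By the quasi-multiplicative bound, a positive first moment keeps all later ones positive. *)
have am_gt0 p : 0 < am p.
  elim: p => [|p IH]; first by rewrite am0.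
  rewrite -(pmulr_lgt0 _ Sgt) -addn1; apply: lt_le_trans (am_sup p 1%N).
  by rewrite !mulr_gt0.
have [||K [K0 K1 K2 K3]] := @quasi_multiplicative_growth R am (c / S) _ am_gt0 am0 moment_submul.
- by rewrite divr_gt0.
- by move=> n p; rewrite mulrAC ler_pdivrMr.
exists J, c, (c / S), K; split => //; exact: divr_gt0.
Qed.

End Decay.

Section NormalizedIterates.
Context {R : realType} {d : nat}.
Local Notation M := 'M[R[i]]_d.
Variable mu : {sigma_finite_measure set M -> \bar R}.
Local Notation P := (transfer mu).
Variables (s K b : R).
Hypothesis d_gt0 : (0 < d)%N.
Hypothesis s_gt0 : 0 < s.
Hypothesis mu_moment : (\int[mu]_v (onorm_pow s v)%:E < +oo)%E.
Local Notation N := (efun (@onorm_pow R d s)).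
Hypothesis K_gt0 : 0 < K.
Hypothesis b_gt0 : 0 < b.
Hypothesis mK : forall n, b * fine (iter n P N 1%:M) <= K ^+ n.

Definition normalized_iter (g : M -> R) n A : R :=
  (K ^+ n)^-1 * fine (iter n P (efun g) A).

Variables (g : M -> R) (B : R).
Hypothesis g_cont : continuous g.
Hypothesis g_homog : homog s g.
Hypothesis g_ge0 : forall A, 0 <= g A.
Hypothesis B_ge0 : 0 <= B.
Hypothesis g_le : forall A, g A <= B * onorm_pow s A.
Local Notation u := (normalized_iter g).

Let mN : measurable_fun setT N := @measurable_N R d s s_gt0.
Let N0 : forall A, (0 <= N A)%E := @N_ge0 R d s.
Let mg : measurable_fun setT (efun g) := measurable_efun g_cont.
Let g0 : forall A, (0 <= efun g A)%E := efun_ge0 g_ge0.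
Let Kn n : 0 < K ^+ n. Proof. by rewrite exprn_gt0. Qed.
Let mfin n : iter n P N 1%:M \is a fin_num := m_fin s_gt0 mu_moment n.

Let mle n : (K ^+ n)^-1 * fine (iter n P N 1%:M) <= b^-1.
Proof. by rewrite ler_pdivrMl // ler_pdivlMr // mulrC. Qed.

Let iter_le n A : (iter n P (efun g) A <= B%:E * (N A * iter n P N 1%:M))%E.
Proof.
apply: (@le_trans _ _ (B%:E * iter n P N A)%E); last first.
  by rewrite lee_wpmul2l // iter_transfer_N_le.
rewrite -iter_transferZ //; apply: iter_transfer_le => //.
exact: measurable_funeM.
Qed.

Lemma iter_efun_fin n A : iter n P (efun g) A \is a fin_num.
Proof.
rewrite ge0_fin_numE; last exact: iter_transfer_ge0.
by apply: le_lt_trans (iter_le n A) _; rewrite -(fineK (mfin n)) -!EFinM ltry.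
Qed.

Lemma normalized_iterE n A : (u n A)%:E = ((K ^+ n)^-1%:E * iter n P (efun g) A)%E.
Proof. by rewrite /normalized_iter EFinM fineK // iter_efun_fin. Qed.

Lemma normalized_iter_ge0 n A : 0 <= u n A.
Proof.
by rewrite mulr_ge0 ?invr_ge0 ?(ltW (Kn n)) // fine_ge0 // iter_transfer_ge0.
Qed.

Lemma normalized_iter_le n A : u n A <= B / b * onorm_pow s A.
Proof.
have h : fine (iter n P (efun g) A) <=
    B * (onorm_pow s A * fine (iter n P N 1%:M)).
  rewrite -lee_fin !EFinM !fineK ?iter_efun_fin ?mfin //; exact: iter_le.
apply: le_trans (ler_wpM2l (ltW _) h) _; first by rewrite invr_gt0.
rewrite mulrCA -mulrA ler_wpM2l // mulrCA mulrC ler_wpM2r ?onorm_pow_ge0 //.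
Qed.

Lemma normalized_iter_homog n : homog s (u n).
Proof.
move=> c A c0; rewrite /normalized_iter (iter_transfer_homog _ _ _ (@g_homog)) //.
by rewrite fineM ?iter_efun_fin //= mulrCA.
Qed.

(** The pointwise error [e * b * onorm_pow s S] integrates to [e * b] times the [n]-th moment, which
    is at most [e * K ^+ n] by [mK]; this is why the modulus is requested for [e * b]. *)
Lemma normalized_iter_equicontinuous (A : M) e : 0 < e ->
  exists2 k : R, 0 < k &
    forall X, onorm (X - A) < k -> forall n, `|u n X - u n A| <= e.
Proof.
move=> e0; have eb : 0 < e * b by rewrite mulr_gt0.
have [k k0 hk] := mulmx_equicontinuous A s_gt0 g_cont (@g_homog) eb.
exists k => // X hX n.
have le_aux Y Z : (forall S, g (S *m Y) <= g (S *m Z) + e * b * onorm_pow s S) ->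
    u n Y <= u n Z + e.
  move=> h; have : fine (iter n P (efun g) Y) <=
      fine (iter n P (efun g) Z) + e * b * fine (iter n P N 1%:M).
    rewrite -lee_fin EFinD EFinM !fineK ?iter_efun_fin ?mfin //.
    rewrite (iter_transfer_shift _ _ _ Y) (iter_transfer_shift _ _ _ Z).
    rewrite -(iter_transferZ _ _ (ltW eb)) // -iter_transferD //.
    - apply: iter_transfer_le => //.
      + exact: measurable_comp_mulmxr.
      + apply: emeasurable_funD; first exact: measurable_comp_mulmxr.
        exact: measurable_funeM.
    - by move=> S; rewrite mule_ge0 // lee_fin ltW.
    - exact: measurable_comp_mulmxr.
    - exact: measurable_funeM.
  move=> h'; apply: le_trans (ler_wpM2l (ltW _) h') _; first by rewrite invr_gt0.
  rewrite mulrDr lerD2l mulrCA -ler_pdivlMl // invfM -mulrA.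
  by rewrite mulrCA mulVf ?gt_eqF // mulr1; exact: mle.
rewrite ler_distl lerBlDr; apply/andP; split; apply: le_aux => S.
  by have := hk X hX S; rewrite distrC ler_distl => /andP[].
by have := hk X hX S; rewrite ler_distl => /andP[].
Qed.

Lemma normalized_iter_continuous n : continuous (u n).
Proof.
move=> A; apply: continuous_onormP => e e0; have e2 : 0 < e / 2 by rewrite divr_gt0.
have [k k0 hk] := normalized_iter_equicontinuous A e2; exists k => // X hX.
apply: le_lt_trans (hk X hX n) _.
by rewrite ltr_pdivrMr // mulr_natr mulr2n ltrDl.
Qed.

Lemma normalized_iter_transfer n A :
  (\int[mu]_v (u n (v *m A))%:E = (K * u n.+1 A)%:E)%E.
Proof.
under eq_integral do rewrite normalized_iterE.
rewrite ge0_integralZl_EFin //.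
- rewrite EFinM normalized_iterE muleA -EFinM; congr (_%:E * _)%E.
  by rewrite exprS invfM mulrA divff ?mul1r // gt_eqF.
- by move=> v _; exact: iter_transfer_ge0.
- by apply: measurable_comp_mulmxr; exact: measurable_iter_transfer.
- by rewrite invr_ge0 ltW.
Qed.

End NormalizedIterates.

Lemma continuous_oppr (T : topologicalType) (R : realType) (f : T -> R) :
  continuous f -> continuous (fun x => - f x).
Proof. by move=> cf x; apply: cvgN; exact: cf. Qed.

Lemma continuous_sumZ (T : topologicalType) (R : realType) (J : nat) (r : nat -> R)
    (f : nat -> T -> R) : (forall j, continuous (f j)) ->
  continuous (fun x => \sum_(j < J) r j * f j x).
Proof.
move=> cf x; elim: J => [|J IH].
  by under eq_fun do rewrite big_ord0; exact: cvg_cst.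
under eq_fun do rewrite big_ord_recr /=.
apply: cvgD; first exact: IH.
by apply: cvgM; [exact: cvg_cst|exact: cf].
Qed.

(** * Convergence to zero of the normalized exterior-square moments *)

Section WedgeDecay.
Context {R : realType} {d : nat}.
Local Notation M := 'M[R[i]]_d.
Variable mu : {sigma_finite_measure set M -> \bar R}.
Local Notation P := (transfer mu).
Variables (alpha s K b c : R) (J : nat).
Hypothesis d_gt0 : (0 < d)%N.
Hypothesis alpha_gt0 : 0 < alpha.
Hypothesis s_alpha : 0 < s - 2 * alpha.
Hypothesis mu_irr : mx_irreducible mu.
Hypothesis mu_contr : mx_contracting mu.
Hypothesis mu_moment : (\int[mu]_v (onorm_pow s v)%:E < +oo)%E.
Local Notation Nr := (@onorm_pow R d s).
Local Notation N := (efun Nr).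
Hypothesis K_gt0 : 0 < K.
Hypothesis b_gt0 : 0 < b.
Hypothesis c_gt0 : 0 < c.
Hypothesis mK : forall n, b * fine (iter n P N 1%:M) <= K ^+ n.
Hypothesis Km : forall n, K ^+ n <= fine (iter n P N 1%:M).
Hypothesis m_lower : forall p (A : M), ((c * onorm_pow s A *
   fine (iter p P N 1%:M))%:E <= \sum_(j < J) iter j P (iter p P N) A)%E.

Let s_gt0 : 0 < s.
Proof. by have := s_alpha; rewrite subr_gt0; apply: le_lt_trans; rewrite mulr_ge0 // ltW. Qed.

Let Nr_cont : continuous Nr := onorm_pow_continuous s_gt0.
Let Nr_homog : homog s Nr := @homog_onorm_pow R d s.
Let Nr_ge0 : forall A, 0 <= Nr A := @onorm_pow_ge0 R d s.
Let Nr_le : forall A, Nr A <= 1 * Nr A.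
Proof. by move=> A; rewrite mul1r. Qed.
Let Nr_u j A : (normalized_iter mu K Nr j A)%:E = ((K ^+ j)^-1%:E * iter j P N A)%E.
Proof. exact: (@normalized_iterE R d mu s K s_gt0 mu_moment _ _ Nr_cont Nr_ge0 ler01 Nr_le j A). Qed.

(* The sum of the first J iterates of the norm power: its normalized iterates are
   bounded below by a multiple of the norm power, see [m_lower]. *)
Let g A : R := \sum_(j < J) K ^+ j * normalized_iter mu K Nr j A.

Let gE A : efun g A = (\sum_(j < J) iter j P N A)%E.
Proof.
rewrite /efun /g -sumEFin; apply: eq_bigr => j _.
by rewrite EFinM Nr_u muleA -EFinM divff ?mul1e // expf_neq0 // gt_eqF.
Qed.

Let g_cont : continuous g.
Proof.
apply: (continuous_sumZ (r := fun j => K ^+ j) (f := normalized_iter mu K Nr)) => j.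
exact: (@normalized_iter_continuous R d mu s K b s_gt0 mu_moment K_gt0 b_gt0 mK _ _ Nr_cont (@Nr_homog) Nr_ge0 ler01 Nr_le j).
Qed.

Let g_homog : homog s g.
Proof.
move=> r A r0; rewrite /g mulr_sumr; apply: eq_bigr => j _.
have -> : normalized_iter mu K Nr j (r%:C%C *: A) = r `^ s * normalized_iter mu K Nr j A.
  exact: (@normalized_iter_homog R d mu s K s_gt0 mu_moment _ _ Nr_cont (@Nr_homog) Nr_ge0 ler01 Nr_le j r A r0).
by rewrite mulrCA.
Qed.

Let g_ge0 A : 0 <= g A.
Proof.
apply: sumr_ge0 => j _; rewrite mulr_ge0 ?exprn_ge0 ?(ltW K_gt0) //.
exact: normalized_iter_ge0.
Qed.

Let B := \sum_(j < J) K ^+ j * (1 / b).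

Let B_ge0 : 0 <= B.
Proof.
apply: sumr_ge0 => j _; rewrite mulr_ge0 ?exprn_ge0 ?(ltW K_gt0) //.
by rewrite divr_ge0 // ltW.
Qed.

Let g_le A : g A <= B * Nr A.
Proof.
rewrite /g /B mulr_suml; apply: ler_sum => j _; rewrite -mulrA ler_wpM2l //.
  by rewrite exprn_ge0 // ltW.
exact: (@normalized_iter_le R d mu s K b s_gt0 mu_moment K_gt0 b_gt0 mK _ _ Nr_cont Nr_ge0 ler01 Nr_le j A).
Qed.

Let phi := @wedge_pow R d alpha s.
Let phi_cont : continuous phi := wedge_pow_continuous alpha_gt0 s_alpha.
Let phi_homog : homog s phi := @homog_wedge_pow R d alpha s s_gt0.
Let phi_ge0 : forall A, 0 <= phi A := @wedge_pow_ge0 R d alpha s.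
Let phi_le A : phi A <= 1 * Nr A.
Proof. by rewrite mul1r; exact: wedge_pow_le. Qed.

Let limsup_phi : exists F : M -> R,
  [/\ continuous F, homog s F,
      forall A, ((K * F A)%:E <= \int[mu]_v (F (v *m A))%:E)%E,
      forall A c, (forall n, normalized_iter mu K phi n A <= c) -> F A <= c &
      forall A e, 0 < e -> \forall n \near \oo, normalized_iter mu K phi n A < F A + e].
Proof.
have u0 := normalized_iter_ge0 mu K_gt0 phi_ge0.
apply: (limsup_subharmonic (C := 1 / b)) => //.
- by rewrite divr_ge0 // ltW.
- by move=> n A; rewrite ger0_norm //; exact: (@normalized_iter_le R d mu s K b s_gt0 mu_moment K_gt0 b_gt0 mK _ _ phi_cont phi_ge0 ler01 phi_le n A).
- by move=> A e e0; exact: (@normalized_iter_equicontinuous R d mu s K b s_gt0 mu_moment K_gt0 b_gt0 mK _ _ phi_cont (@phi_homog) phi_ge0 ler01 phi_le A e e0).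
- by move=> n; exact: (@normalized_iter_homog R d mu s K s_gt0 mu_moment _ _ phi_cont (@phi_homog) phi_ge0 ler01 phi_le n).
- by move=> n A; exact: (@normalized_iter_transfer R d mu s K s_gt0 mu_moment K_gt0 _ _ phi_cont phi_ge0 ler01 phi_le n A).
Qed.

(** The opposite of the limsup of the opposites: subharmonicity becomes superharmonicity, and the
    bound [lower], uniform in [n], gives positivity away from [0]. *)
Let liminf_g : exists G : M -> R,
  [/\ continuous G, homog s G,
      forall A, (\int[mu]_v (G (v *m A))%:E <= (K * G A)%:E)%E &
      forall A, A != 0 -> 0 < G A].
Proof.
have u0 := normalized_iter_ge0 mu K_gt0 g_ge0.
(* Iterates commute, so the [n]-th iterate of [g] is the sum bounded in [m_lower] with [p = n]; [Km]
   then absorbs the normalization. *)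
have lower n A : c * Nr A <= normalized_iter mu K g n A.
  rewrite -lee_fin [leRHS](_ : _ = ((K ^+ n)^-1%:E * iter n P (efun g) A)%E); last first.
    exact: (@normalized_iterE R d mu s K s_gt0 mu_moment _ _ g_cont g_ge0 B_ge0 g_le n A).
  rewrite (_ : efun g = fun X => (\sum_(j < J) iter j P N X)%E); last first.
    by apply/funext => X; exact: gE.
  rewrite iter_transfer_sum; last 2 first.
  - by move=> j X; apply: iter_transfer_ge0; exact: N_ge0.
  - by move=> j; apply: measurable_iter_transfer; [exact: N_ge0|exact: measurable_N].
  have -> : (\sum_(j < J) iter n P (iter j P N) A = \sum_(j < J) iter j P (iter n P N) A)%E.
    by apply: eq_bigr => j _; rewrite -!iterD addnC.
  apply: (@le_trans _ _ ((K ^+ n)^-1%:E * (c * Nr A * fine (iter n P N 1%:M))%:E)%E).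
    rewrite -EFinM lee_fin -ler_pdivrMl ?invr_gt0 ?exprn_gt0 // invrK mulrC.
    by rewrite ler_wpM2l // mulr_ge0 // ltW.
  by rewrite lee_wpmul2l // lee_fin invr_ge0 exprn_ge0 // ltW.
pose f n A := - normalized_iter mu K g n A.
have [||||||F [cF hF PF Fle _]] := @limsup_subharmonic R d mu s K (B / b) f s_gt0 K_gt0.
- by rewrite divr_ge0 // ltW.
- move=> n A; rewrite /f normrN ger0_norm //; exact: (@normalized_iter_le R d mu s K b s_gt0 mu_moment K_gt0 b_gt0 mK _ _ g_cont g_ge0 B_ge0 g_le n A).
- move=> A e e0.
  have [k k0 hk] : exists2 k : R, 0 < k & forall X, onorm (X - A) < k -> forall n,
      `|normalized_iter mu K g n X - normalized_iter mu K g n A| <= e.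
    exact: (@normalized_iter_equicontinuous R d mu s K b s_gt0 mu_moment K_gt0 b_gt0 mK _ _ g_cont (@g_homog) g_ge0 B_ge0 g_le A e e0).
  by exists k => // X hX n; rewrite /f opprK addrC distrC; exact: hk.
- move=> n r A r0; rewrite /f mulrN; congr (- _).
  exact: (@normalized_iter_homog R d mu s K s_gt0 mu_moment _ _ g_cont (@g_homog) g_ge0 B_ge0 g_le n r A r0).
- move=> n A; rewrite /f; under eq_integral do rewrite EFinN.
  rewrite integral_ge0N; last by move=> v _; rewrite lee_fin.
  rewrite mulrN EFinN; congr (- _)%E.
  exact: (@normalized_iter_transfer R d mu s K s_gt0 mu_moment K_gt0 _ _ g_cont g_ge0 B_ge0 g_le n A).
- exact: mu_moment.
have FN A : F A <= - (c * Nr A) by apply: Fle => n; rewrite /f lerN2.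
exists (fun A => - F A); split.
- exact: continuous_oppr.
- by move=> r A r0; rewrite hF // mulrN.
- move=> A; rewrite mulrN EFinN leeNr; apply: le_trans (PF A) _.
  rewrite -integral_ge0N; last first.
    move=> v _; rewrite lee_fin oppr_ge0; apply: le_trans (FN _) _.
    by rewrite oppr_le0 mulr_ge0 // ltW.
  by under [leRHS]eq_integral do rewrite -EFinN opprK.
- move=> A A0; rewrite oppr_gt0; apply: le_lt_trans (FN A) _.
  by rewrite oppr_lt0 mulr_gt0 // powR_gt0 // onorm_gt0.
Qed.

Lemma wedge_decay e : 0 < e ->
  \forall n \near \oo, normalized_iter mu K phi n 1%:M < e.
Proof.
move=> e0; have [F [cF hF PF Fle Fge]] := limsup_phi.
have [G [cG hG PG G0]] := liminf_g.
have u0 := normalized_iter_ge0 mu K_gt0 phi_ge0.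
have F0 : F 1%:M = 0.
  apply: (@max_principle R d mu s K F G) => //.
    move=> A; apply/ler_addgt0Pr => x x0.
    have [n _ /(_ n (leqnn n)) /= hn] := Fge A x x0.
    by apply: le_trans (ltW hn); exact: u0.
  (* If [A] has rank at most one, so has every product [X *m A]; the function integrated is then
     identically zero for every [n]. *)
  move=> A rA; apply/le_anti/andP; split; last first.
    apply/ler_addgt0Pr => x x0.
    have [n _ /(_ n (leqnn n)) /= hn] := Fge A x x0.
    by apply: le_trans (ltW hn); exact: u0.
  apply: Fle => n; rewrite /normalized_iter iter_transfer_shift.
  have -> : (fun X => efun phi (X *m A)) = (fun=> 0%E).
    apply/funext => X; rewrite /efun /phi wedge_pow_rank1 ?gt_eqF //.
    exact: leq_trans (mxrankM_maxr _ _) rA.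
  suff -> : iter n P (fun=> 0%E) 1%:M = 0%E by rewrite mulr0.
  elim: n 1%:M => //= n IH X; rewrite /transfer.
  by under eq_integral do rewrite IH; rewrite integral0.
by apply: filterS (Fge 1%:M e e0) => n; rewrite F0 add0r.
Qed.

End WedgeDecay.

(** One index [N] with [h N <= 1/2] suffices: division of [n] by [N] gives decay like [2^-1] to the
    power [n / N], with the finitely many remainders bounded by [D]. *)
Lemma submul_decay (R : realType) (h : nat -> R) :
  (forall n, 0 <= h n) -> (forall n p, h (n + p)%N <= h n * h p) ->
  (forall e, 0 < e -> \forall n \near \oo, h n < e) ->
  exists (lambda : R) (n0 : nat), [/\ 0 < lambda, lambda < 1 &
    forall n, (n0 <= n)%N -> h n <= lambda ^+ n].
Proof.
move=> h0 hM hlim.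
have [N N0 hN] : exists2 N, (0 < N)%N & h N <= 2^-1.
  have half0 : 0 < 2^-1 :> R by rewrite invr_gt0.
  have [n _ hn] := hlim _ half0; exists n.+1 => //.
  by apply: ltW; apply: hn; rewrite /= leqnSn.
pose D := 1 + \sum_(r < N) h r.
have D0 : 0 < D by rewrite ltr_wpDr // sumr_ge0.
have hD r : (r < N)%N -> h r <= D.
  move=> rN; rewrite /D (bigD1 (Ordinal rN)) //= addrCA lerDl addr_ge0 //.
  exact: sumr_ge0.
(* The exponent has [2 * N] instead of [N]: [h n] is then bounded by [2 * D * l ^+ n * l ^+ n], and
   one of the two powers absorbs the constant [2 * D] for large [n]. *)
pose l : R := 2^-1 `^ (2 * N)%:R^-1.
have l0 : 0 < l by rewrite powR_gt0.
have lN : l ^+ (2 * N) = 2^-1.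
  rewrite -powR_mulrn ?powR_ge0 // -powRrM mulVf ?powRr1 //.
  by rewrite pnatr_eq0 muln_eq0 /= -lt0n.
have l1 : l < 1.
  rewrite -(ltr_pXn2r (n := 2 * N)) ?muln_gt0 // ?nnegrE ?(ltW l0) //.
  by rewrite lN expr1n invf_lt1 // ltr1n.
have hq q r : h (q * N + r)%N <= (l ^+ (2 * N)) ^+ q * h r.
  elim: q => [|q IH]; first by rewrite mul0n add0n expr0 mul1r.
  rewrite mulSn -addnA exprS -mulrA; apply: le_trans (hM _ _) _.
  by apply: ler_pM => //; rewrite lN.
have hn n : h n <= 2 * D * l ^+ n * l ^+ n.
  rewrite {1}(divn_eq n N); apply: le_trans (hq _ _) _.
  have rN : (n %% N < N)%N by rewrite ltn_mod.
  apply: (@le_trans _ _ ((l ^+ (2 * N)) ^+ (n %/ N) * D)).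
    by rewrite ler_wpM2l ?exprn_ge0 ?(ltW l0) // hD.
  have ln : l ^+ n * l ^+ n = (l ^+ (2 * N)) ^+ (n %/ N) * l ^+ (2 * (n %% N)).
    rewrite -exprD addnn -mul2n {1}(divn_eq n N) mulnDr exprD.
    by rewrite (mulnC (n %/ N)%N) mulnA exprM.
  have : l ^+ (2 * N) <= l ^+ (2 * (n %% N)).
    by rewrite ler_wiXn2l ?(ltW l0) ?(ltW l1) // leq_mul2l /= ltnW.
  move=> hz; rewrite -[leRHS]mulrA ln; move: hz; rewrite lN.
  set x := 2^-1 ^+ _; move: (l ^+ _) => z hz.
  have x0 : 0 <= x * D by rewrite mulr_ge0 ?(ltW D0) // exprn_ge0.
  rewrite (_ : 2 * D * (x * z) = x * D * (2 * z)); last by ring.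
  by rewrite ler_peMr //; move: hz; lra.
have : (fun n => 2 * D * l ^+ n) @ \oo --> (0 : R).
  rewrite -[X in _ --> X](mulr0 (2 * D)); apply: cvgMl_tmp.
  by apply: cvg_expr; rewrite ger0_norm // ltW.
move=> /cvgrPdist_lt/(_ 1 ltr01) [n0 _ hn0]; exists l, n0; split => // n n0n.
apply: le_trans (hn n) _; rewrite ler_piMl ?exprn_ge0 ?(ltW l0) //.
have := hn0 n n0n; rewrite /= sub0r normrN => /ltW; apply: le_trans.
exact: ler_norm.
Qed.

(** * The statement for sigma-finite measures *)

Section SigmaFiniteCase.
Context {R : realType} {d : nat}.
Local Notation M := 'M[R[i]]_d.
Variable mu : {sigma_finite_measure set M -> \bar R}.
Local Notation P := (transfer mu).
Variables (alpha s : R).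
Hypothesis d_gt0 : (0 < d)%N.
Hypothesis alpha_gt0 : 0 < alpha.
Hypothesis s_alpha : 0 < s - 2 * alpha.
Hypothesis mu_irr : mx_irreducible mu.
Hypothesis mu_contr : mx_contracting mu.
Hypothesis mu_moment : (\int[mu]_v (opnorm v `^ s)%:E < +oo)%E.
Local Notation Nr := (@onorm_pow R d s).
Local Notation phi := (@wedge_pow R d alpha s).
Local Notation m p := (iter p P (efun Nr) 1%:M).

Let s_gt0 : 0 < s.
Proof. by have := s_alpha; rewrite subr_gt0; apply: le_lt_trans; rewrite mulr_ge0 // ltW. Qed.

Let moment_Nr : (\int[mu]_v (Nr v)%:E < +oo)%E.
Proof. by move: mu_moment; rewrite /onorm_pow onorm.unlock. Qed.

Lemma moment_iter n : moment mu s n = m n.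
Proof.
rewrite -integral_pow_measure; last 2 first.
- exact: N_ge0.
- exact: measurable_N.
rewrite /moment; congr integral; apply/funext => t.
by rewrite mulmx1 /efun /onorm_pow onorm.unlock.
Qed.

Lemma wedge_moment_iter n :
  (\int[pow_measure mu n]_t (ext2_norm (mx_prod t) `^ alpha *
      opnorm (mx_prod t) `^ (s - 2 * alpha))%:E = iter n P (efun phi) 1%:M)%E.
Proof.
rewrite -integral_pow_measure; last 2 first.
- by move=> A; rewrite lee_fin wedge_pow_ge0.
- by apply: measurable_efun; exact: wedge_pow_continuous.
congr integral; apply/funext => t.
by rewrite mulmx1 /efun /wedge_pow onorm.unlock wnorm.unlock.
Qed.

Let phi_le A : phi A <= Nr A. Proof. exact: wedge_pow_le. Qed.
Let phi_le1 A : phi A <= 1 * Nr A. Proof. by rewrite mul1r. Qed.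
Let phi_ge0 (A : M) : 0 <= phi A. Proof. exact: wedge_pow_ge0. Qed.
Let phi_cont : continuous phi := wedge_pow_continuous alpha_gt0 s_alpha.

Lemma sigma_finite_case : hfun mu alpha s @ \oo --> 0%E /\
  exists (lambda : R) (n0 : nat), [/\ 0 < lambda, lambda < 1 &
    forall n : nat, (n0 <= n)%N -> (hfun mu alpha s n <= (lambda ^+ n)%:E)%E].
Proof.
have mphi : measurable_fun setT (efun phi) by exact: measurable_efun.
(* A zero first moment, as for the Dirac mass at [0] in dimension one, gives no positive growth
   rate. By submultiplicativity all later moments vanish, so [hfun] is zero from [n = 1] on,
   whatever its prefactor. *)
have [m1|m1] := eqVneq (fine (m 1)) 0.
  have h0 n : hfun mu alpha s n.+1 = 0%E.
    rewrite /hfun wedge_moment_iter (_ : iter _ _ _ _ = 0%E) ?mule0 //.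
    apply/le_anti/andP; split; last first.
      by apply: iter_transfer_ge0 => A; rewrite lee_fin.
    apply: (@le_trans _ _ (m n.+1)).
      by apply: iter_transfer_le => //; exact: measurable_N.
    rewrite -(fineK (m_fin s_gt0 moment_Nr _)) lee_fin.
    by have := moment_submul s_gt0 moment_Nr n 1; rewrite m1 mulr0 addn1.
  split.
    rewrite -cvg_shiftS; rewrite (_ : [sequence _]_n = cst 0%E); first exact: cvg_cst.
    by apply/funext => n /=; exact: h0.
  exists 2^-1, 1%N; split => //; first by rewrite invf_lt1 // ltr1n.
  by case=> // n _; rewrite h0 lee_fin exprn_ge0.
have m1gt : 0 < fine (m 1).
  by rewrite lt_neqAle eq_sym m1 fine_ge0 // iter_transfer_ge0 // => A; exact: N_ge0.
have [J [c [b [K [c0 b0 K0 lowerm [Km mK cvgK]]]]]] :=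
  moment_growth d_gt0 s_gt0 mu_irr moment_Nr m1gt.
have kK : kfun mu s = K.
  rewrite /kfun (_ : (fun n => _) = EFin \o (fun n => fine (m n) `^ n%:R^-1)).
    rewrite (_ : limn _ = K%:E) //; apply/cvg_lim => //.
    by apply: cvg_EFin; [exact: nearW|exact: cvgK].
  apply/funext => n /=; rewrite moment_iter -(fineK (m_fin s_gt0 moment_Nr n)).
  by rewrite poweR_EFin.
pose h n := normalized_iter mu K phi n 1%:M.
have hE n : hfun mu alpha s n = (h n)%:E.
  rewrite /hfun kK wedge_moment_iter /h; apply/esym.
  exact: (@normalized_iterE R d mu s K s_gt0 moment_Nr _ _ phi_cont phi_ge0 ler01 phi_le1).
have h0 n : 0 <= h n by exact: normalized_iter_ge0.
have hlim e : 0 < e -> \forall n \near \oo, h n < e.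
  exact: (@wedge_decay R d mu alpha s K b c J alpha_gt0 s_alpha mu_irr mu_contr
    moment_Nr K0 b0 c0 mK Km lowerm).
have phi_fin n : iter n P (efun phi) 1%:M \is a fin_num.
  exact: (@iter_efun_fin R d mu s s_gt0 moment_Nr _ _ phi_cont phi_ge0 ler01 phi_le1).
(* Integrates [wedge_powM] over the last [n] and the first [p] factors separately. *)
have hM n p : h (n + p)%N <= h n * h p.
  have : fine (iter (n + p) P (efun phi) 1%:M) <=
      fine (iter p P (efun phi) 1%:M) * fine (iter n P (efun phi) 1%:M).
    rewrite -lee_fin EFinM !fineK // iterD.
    rewrite -{1}(fineK (phi_fin p)) -iter_transferZ //; last first.
      by rewrite fine_ge0 // iter_transfer_ge0 // => A; rewrite lee_fin.
    apply: iter_transfer_le.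
    - by apply: iter_transfer_ge0 => A; rewrite lee_fin.
    - by apply: measurable_iter_transfer => // A; rewrite lee_fin.
    - exact: measurable_funeM.
    move=> X; rewrite iter_transfer_shift fineK // muleC -[efun phi X]/(phi X)%:E.
    rewrite -iter_transferZ //.
    apply: iter_transfer_le.
    - by move=> A; rewrite lee_fin.
    - exact: measurable_comp_mulmxr.
    - exact: measurable_funeM.
    - by move=> A; rewrite -EFinM lee_fin mulrC; apply: wedge_powM => //; exact: ltW.
  rewrite /h /normalized_iter exprD invfM mulrACA => hle.
  by rewrite ler_wpM2l ?mulr_ge0 ?invr_ge0 ?exprn_ge0 ?(ltW K0) // mulrC.
split.
  rewrite (_ : hfun mu alpha s = EFin \o h); last by apply/funext => n; exact: hE.
  apply: cvg_EFin; first exact: nearW.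
  apply/cvgrPdist_lt => e e0; apply: filterS (hlim e e0) => n /=.
  by rewrite sub0r normrN ger0_norm.
have [l [n0 [l0 l1 hl]]] := submul_decay h0 hM hlim.
by exists l, n0; split => // n n0n; rewrite hE lee_fin; exact: hl.
Qed.

End SigmaFiniteCase.

(** * Reduction to sigma-finite measures *)

Section MeasuresAgreeing.
Import HBNNSimple.
Local Open Scope ereal_scope.

(** [m1] and [m2] are bare set functions here, as [pow_measure] is, so the integral is unfolded to
    suprema over simple functions. Below a function vanishing off [D], the level sets of a simple
    function at nonzero values lie in [D]. *)
Lemma integral_agree disp (T : measurableType disp) (R : realType)
    (m1 m2 : set T -> \bar R) (D : set T) (f : T -> \bar R) :
  (forall A, measurable A -> A `<=` D -> m1 A = m2 A) ->
  (forall x, ~ D x -> f x = 0) ->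
  \int[m1]_x f x = \int[m2]_x f x.
Proof.
move=> m12 f0.
pose simple_below (m : set T -> \bar R) (g : T -> \bar R) :=
  [set sintegral m h | h in [set h : {nnsfun T >-> R} | forall x, (h x)%:E <= g x]].
have sub m m' g : (forall A, measurable A -> A `<=` D -> m A = m' A) ->
    (forall x, ~ D x -> g x = 0) -> simple_below m g `<=` simple_below m' g.
  move=> mm g0 _ [h hg <-]; exists h => //; apply: eq_fsbigr => r _.
  have [->|r0] := eqVneq r 0%R; first by rewrite !mul0e.
  rewrite mm // => x /= hx; apply: contrapT => Dx; have := hg x.
  rewrite g0 // hx lee_fin => r_le0; move/eqP: r0; apply.
  by apply/le_anti; rewrite r_le0 -hx fun_ge0.
have eqsup g : (forall x, ~ D x -> g x = 0) ->
    ereal_sup (simple_below m1 g) = ereal_sup (simple_below m2 g).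
  move=> g0; congr ereal_sup; apply/seteqP; split; apply: sub => //.
  by move=> A mA AD; rewrite m12.
rewrite /integral; congr (_ - _); apply: eqsup => x Dx.
  by rewrite funeposE patchE in_setT f0 // maxxx.
by rewrite funenegE patchE in_setT f0 // oppe0 maxxx.
Qed.

(** Sections of [A] stay in the corresponding power of [D] and are empty over points outside [D], so
    [integral_agree] applies to the outer integral. *)
Lemma pow_measure_agree disp (T : measurableType disp) (R : realType)
    (m1 m2 : {measure set T -> \bar R}) (D : set T) (n : nat) (A : set (n.-tuple T)) :
  (forall B, measurable B -> B `<=` D -> m1 B = m2 B) ->
  measurable A -> A `<=` [set t | forall i, D (tnth t i)] ->
  pow_measure m1 n A = pow_measure m2 n A.
Proof.
move=> m12; elim: n A => //= n IH A mA AD.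
set B := [set _ | _].
have mB : measurable B.
  have mcons : measurable_fun setT (fun p : T * n.-tuple T => [tuple of p.1 :: p.2]).
    exact: measurable_cons.
  by rewrite -[B]setTI; exact: mcons.
have BD x t : B (x, t) -> D x /\ forall i, D (tnth t i).
  move=> /AD /= h; split; first by have := h ord0; rewrite tnth0.
  by move=> i; have := h (lift ord0 i); rewrite tnthS.
rewrite /product_measure1 /=.
under eq_integral => x _.
  rewrite IH; last 2 first.
  - exact: measurable_xsection.
  - by move=> t /xsectionP /BD[].
  over.
apply: (integral_agree m12) => x Dx.
rewrite (_ : xsection B x = set0) ?pow_measure0 // -subset0 => t /xsectionP /BD[].
by move/Dx.
Qed.

End MeasuresAgreeing.

Section DiscardZero.
Context {R : realType} {d : nat}.
Local Notation M := 'M[R[i]]_d.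

Lemma mx_prod_eq0 n (t : n.-tuple M) i : tnth t i = 0 -> mx_prod t = 0.
Proof.
elim: n t i => [|n IH] t i; first by case: i.
case/tupleP: t => x t; rewrite mx_prod_cons.
have [j|] := unliftP ord0 i => ->; first by rewrite tnthS => /IH ->; rewrite mul0mx.
by rewrite tnth0 => ->; rewrite mulmx0.
Qed.

Let D : set M := [set v | v != 0].

Let open_D : open D.
Proof.
rewrite (_ : D = [set v | 0 < onorm v]); last first.
  by apply/seteqP; split => v; rewrite /D /= onorm_gt0.
by apply: open_comp (@open_gt _ 0) => v _; exact: onorm_continuous.
Qed.

Let mD : measurable D := open_measurable_mx open_D.

Variable mu : {measure set M -> \bar R}.
Variables (alpha s : R).
Hypothesis s_gt0 : 0 < s.
Hypothesis s_alpha : 0 < s - 2 * alpha.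
Hypothesis mu_moment : (\int[mu]_v (opnorm v `^ s)%:E < +oo)%E.

Let restr_sigma_finite : sigma_finite setT (mrestr mu mD).
Proof.
pose E (k : nat) : set M := [set v | k.+1%:R^-1 < onorm v].
have mE k : measurable (E k).
  apply: open_measurable_mx; apply: open_comp (@open_gt _ _) => v _.
  exact: onorm_continuous.
(* Markov's inequality for the [s]-th moment bounds the measure of each [E k]. These sets exhaust
   [D]; the complement of [D], null for the restriction, is added to cover the whole space. *)
exists (fun k => E k `|` ~` D); last first.
  move=> k; split; first by apply: measurableU => //; exact: measurableC.
  rewrite /mrestr setIUl setICl setU0 (setIidl (_ : E k `<=` D)); last first.
    by move=> v; rewrite /E /D /= -onorm_gt0; apply: lt_trans; rewrite invr_gt0.
  pose e : R := k.+1%:R^-1 `^ s.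
  have e0 : 0 < e by rewrite powR_gt0 // invr_gt0.
  have : (e%:E * mu (E k) <= \int[mu]_v (onorm v `^ s)%:E)%E.
    apply: integral_ge_on => //.
    - exact: (@measurable_N R d s).
    - by move=> v; rewrite lee_fin powR_ge0.
    - exact: ltW.
    - move=> v Ev; rewrite lee_fin ge0_ler_powR ?nnegrE ?invr_ge0 ?onorm_ge0 ?(ltW s_gt0) //.
      exact: ltW.
  rewrite onorm.unlock => /le_lt_trans/(_ mu_moment).
  case: (mu (E k)) => [r _||_]; first by rewrite ltry.
    by rewrite gt0_muley ?lte_fin.
  by [].

apply/esym; rewrite -subTset => v _.
have [->|v0] := eqVneq v 0; first by exists 0%N => //; right; rewrite /D /= eqxx.
have : 0 < onorm v by rewrite onorm_gt0.
move=> /ltr_add_invr [k]; rewrite add0r => hk; exists k => //; left.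
exact: hk.
Qed.

(* The moment condition does not control mu at 0, so mu need not be sigma-finite;
   but products with a zero factor contribute to none of the integrals. *)
Lemma discard_zero : exists mu' : {sigma_finite_measure set M -> \bar R},
  [/\ hfun mu' alpha s = hfun mu alpha s,
      (\int[mu']_v (opnorm v `^ s)%:E < +oo)%E &
      forall v, msupp mu v -> v != 0 -> msupp mu' v].
Proof.
have [mu' mu'E] : exists mu' : {sigma_finite_measure set M -> \bar R},
  mu' = mrestr mu mD :> (set M -> \bar R).
  by exists (sigma_finite_copy restr_sigma_finite).
exists mu'.
have agree A : measurable A -> A `<=` D -> mu' A = mu A.
  by move=> _ AD; rewrite mu'E /mrestr setIidl.
have pagree n (f : M -> R) : f 0 = 0 ->
    (\int[pow_measure mu' n]_t (f (mx_prod t))%:E =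
     \int[pow_measure mu n]_t (f (mx_prod t))%:E)%E.
  move=> f0; apply: (@integral_agree _ _ _ _ _ [set t | forall i, D (tnth t i)]).
    by move=> A mA; exact: pow_measure_agree.
  move=> t /existsNP[i /negP]; rewrite negbK => /eqP /mx_prod_eq0 ->.
  by rewrite f0.
have N0 : opnorm (0 : M) = 0 by have := @onorm0 R d; rewrite onorm.unlock.
have mom n : moment mu' s n = moment mu s n.
  by apply: pagree (fun v => opnorm v `^ s) _; rewrite N0 powR0 // gt_eqF.
have kE : kfun mu' s = kfun mu s.
  by rewrite /kfun (_ : moment mu' s = moment mu s) //; apply/funext.
have wedgeE n := @pagree n
  (fun v => ext2_norm v `^ alpha * opnorm v `^ (s - 2 * alpha)) _.
split.
- apply/funext => n; rewrite /hfun kE wedgeE //.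
  by rewrite N0 (powR0 (lt0r_neq0 s_alpha)) mulr0.
- rewrite (integral_agree agree) // => v /negP; rewrite negbK => /eqP ->.
  by rewrite N0 powR0 // gt_eqF.
(* Removing [0] from a neighbourhood of a nonzero matrix leaves it open, so nonzero points of the
   support survive. *)
- move=> v hv v0 U oU Uv; have oUD : open (U `&` D) by exact: openI.
  by rewrite mu'E /mrestr; apply: hv.
Qed.

End DiscardZero.

Lemma mx_semigroup_discard_zero (R : realType) d (mu mu' : set 'M[R[i]]_d -> \bar R) v :
  (forall v, msupp mu v -> v != 0 -> msupp mu' v) ->
  mx_semigroup mu v -> v != 0 -> mx_semigroup mu' v.
Proof.
move=> supp [n [t [ht ->]]] v0; exists n, t; split => // i; apply: supp => //.
by apply: contra_neq v0 => /mx_prod_eq0.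
Qed.

Theorem proposition5p11 (R : realType) (d : nat) (d_ge1 : (1 <= d)%N)
  (mu : {measure set 'M[R[i]]_d -> \bar R})
  (sminus : R) (splus : \bar R)
  (sminus_gt0 : 0 < sminus) (sminus_splus : (sminus%:E < splus)%E)
  (mu_moments : forall t : R, sminus <= t -> (t%:E <= splus)%E ->
     (\int[mu]_v (opnorm v `^ t)%:E < +oo)%E)
  (mu_irr : mx_irreducible mu) (mu_contr : mx_contracting mu)
  (s : R) (sminus_s : sminus < s) (s_splus : (s%:E < splus)%E) :
  let alpha := Num.min (sminus / 3) 1 in
  hfun mu alpha s @ \oo --> 0%E /\
  exists (lambda : R) (n0 : nat), [/\ 0 < lambda, lambda < 1 &
    forall n : nat, (n0 <= n)%N -> (hfun mu alpha s n <= (lambda ^+ n)%:E)%E].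
Proof.
move=> alpha.
have alpha_gt0 : 0 < alpha by rewrite lt_min ltr01 divr_gt0.
have s_gt0 : 0 < s by exact: lt_trans sminus_s.
have s_alpha : 0 < s - 2 * alpha.
  (* With the third of [sminus], the exponent [s - 2 * alpha] exceeds [sminus / 3]. *)
  have : alpha <= sminus / 3 by rewrite ge_min lexx.
  by move: sminus_s sminus_gt0; lra.
have mu_moment := mu_moments s (ltW sminus_s) (ltW s_splus).
have [mu' [<- mu'_moment supp]] := discard_zero s_gt0 s_alpha mu_moment.
apply: (sigma_finite_case (mu := mu')) => //.
(* Every subspace is stable under the zero matrix, so stability under the nonzero points of the
   support is enough. *)
- move=> [F [F0 FT FP]]; apply: mu_irr; exists F; split => // v hv x xF.
  have [->|v0] := eqVneq v 0; first by rewrite mul0mx mem0v.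
  by apply: FP => //; exact: supp.
(* The contracting sequence consists of nonzero products, whose factors are all nonzero. *)
- have [v [w [hv vw rw]]] := mu_contr; exists v, w; split => // k.
  have [Tv v0] := hv k; split => //; exact: (mx_semigroup_discard_zero supp).
Qed.
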